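(* Let $0 \le \alpha < 1$ and let $f = h + \overline{g} \in \mathcal{F}(\alpha)$ with $h(z) = z + \sum_{k=2}^\infty a_k z^k$ and $g(z) = \sum_{k=1}^\infty b_k z^k$. Then for all $n \ge 2$, $$|a_n| \le A_n(\alpha) \quad\text{and}\quad |b_n| \le \frac{n-1}{n-2\alpha}\,A_n(\alpha), \qquad\text{where } A_n(\alpha) = \frac{1}{n!}\prod_{j=2}^n (j - 2\alpha).$$ These bounds are sharp: equality holds in every inequality for the function $f_\alpha = h_\alpha + \overline{g_\alpha} \in \mathcal{F}(\alpha)$ given by $$f_\alpha(z) = \frac{1-(1-z)^{2\alpha-1}}{2\alpha-1} + \overline{\frac{1 - (1-z)^{2\alpha-1}(1 + z(2\alpha-1))}{2\alpha(2\alpha-1)}} \quad (\alpha \ne 0, 1/2),$$ $$f_0(z) = \frac{z}{1-z} + \overline{\frac{z}{1-z} + \log(1-z)}, \qquad f_{1/2}(z) = -\log(1-z) - \overline{\left(z + \log(1-z)\right)},$$ and for its rotations.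
   Context: $\mathbb{D} = \{z \in \mathbb{C} : |z| < 1\}$. For $\alpha \ge -1/2$, $\mathcal{F}(\alpha)$ denotes the set of complex-valued harmonic functions $f = h + \overline{g}$ on $\mathbb{D}$, with $h, g$ analytic in $\mathbb{D}$ normalized by $h(0) = g(0) = 0$, $h'(0) = 1$, such that $\operatorname{Re}\left(1 + \frac{z h''(z)}{h'(z)}\right) > \alpha$ for all $z \in \mathbb{D}$ and, for some real constant $\theta$, $g'(z) = e^{i\theta} z h'(z)$ for all $z \in \mathbb{D}$. Logarithms and powers of $1-z$ use the principal branch on $\mathbb{D}$. *)

(* Defs.v *)
From Stdlib Require Import Reals Lra Arith.
Open Scope R_scope.

Record Cx := mkC { re : R; im : R }.

Definition RtoC (x : R) : Cx := mkC x 0.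
Definition C0 : Cx := RtoC 0.
Definition C1 : Cx := RtoC 1.
Definition Cadd (z w : Cx) : Cx := mkC (re z + re w) (im z + im w).
Definition Copp (z : Cx) : Cx := mkC (- re z) (- im z).
Definition Csub (z w : Cx) : Cx := Cadd z (Copp w).
Definition Cmul (z w : Cx) : Cx :=
  mkC (re z * re w - im z * im w) (re z * im w + im z * re w).
Definition Cinv (z : Cx) : Cx :=
  mkC (re z / (re z ^ 2 + im z ^ 2)) (- im z / (re z ^ 2 + im z ^ 2)).
Definition Cdiv (z w : Cx) : Cx := Cmul z (Cinv w).
Definition Cnorm (z : Cx) : R := sqrt (re z ^ 2 + im z ^ 2).
Fixpoint Cpow (z : Cx) (n : nat) : Cx :=
  match n with O => C1 | S m => Cmul z (Cpow z m) end.

Definition Cexpi (t : R) : Cx := mkC (cos t) (sin t).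
Definition Cexp (z : Cx) : Cx := mkC (exp (re z) * cos (im z)) (exp (re z) * sin (im z)).

(* principal argument, in (-PI, PI] *)
Definition Carg (z : Cx) : R :=
  let x := re z in let y := im z in
  if Rlt_dec 0 x then atan (y / x)
  else if Rlt_dec x 0 then
         (if Rle_dec 0 y then atan (y / x) + PI else atan (y / x) - PI)
  else if Rlt_dec 0 y then PI / 2
  else if Rlt_dec y 0 then - (PI / 2) else 0.

Definition Clog (z : Cx) : Cx := mkC (ln (Cnorm z)) (Carg z).
(* principal power w^c (used only for w <> 0) *)
Definition Cpowc (w c : Cx) : Cx := Cexp (Cmul c (Clog w)).

Definition inD (z : Cx) : Prop := Cnorm z < 1.

Fixpoint Csum (u : nat -> Cx) (N : nat) : Cx :=
  match N with O => u O | S M => Cadd (Csum u M) (u (S M)) end.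

Definition has_sum (u : nat -> Cx) (s : Cx) : Prop :=
  Un_cv (fun N => re (Csum u N)) (re s) /\ Un_cv (fun N => im (Csum u N)) (im s).

Definition Cderiv_at (f : Cx -> Cx) (z l : Cx) : Prop :=
  forall eps, 0 < eps -> exists delta, 0 < delta /\
    forall w, 0 < Cnorm (Csub w z) < delta ->
      Cnorm (Csub (Cdiv (Csub (f w) (f z)) (Csub w z)) l) < eps.

Definition in_F (alpha : R) (h g : Cx -> Cx) : Prop :=
  exists (h1 h2 g1 : Cx -> Cx) (theta : R),
    h C0 = C0 /\ g C0 = C0 /\ h1 C0 = C1 /\
    forall z, inD z ->
      Cderiv_at h z (h1 z) /\ Cderiv_at h1 z (h2 z) /\ Cderiv_at g z (g1 z) /\
      h1 z <> C0 /\
      alpha < re (Cadd C1 (Cdiv (Cmul z (h2 z)) (h1 z))) /\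
      g1 z = Cmul (Cexpi theta) (Cmul z (h1 z)).

Fixpoint prodA (n : nat) (alpha : R) : R :=
  match n with
  | O => 1
  | S O => 1
  | S m => prodA m alpha * (INR (S m) - 2 * alpha)
  end.
Definition A (n : nat) (alpha : R) : R := prodA n alpha / INR (fact n).

Definition h_alpha (alpha : R) (z : Cx) : Cx :=
  if Req_EM_T alpha 0 then Cdiv z (Csub C1 z)
  else if Req_EM_T alpha (1/2) then Copp (Clog (Csub C1 z))
  else Cdiv (Csub C1 (Cpowc (Csub C1 z) (RtoC (2 * alpha - 1)))) (RtoC (2 * alpha - 1)).

Definition g_alpha (alpha : R) (z : Cx) : Cx :=
  if Req_EM_T alpha 0 then Cadd (Cdiv z (Csub C1 z)) (Clog (Csub C1 z))
  else if Req_EM_T alpha (1/2) then Copp (Cadd z (Clog (Csub C1 z)))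
  else Cdiv (Csub C1 (Cmul (Cpowc (Csub C1 z) (RtoC (2 * alpha - 1)))
                           (Cadd C1 (Cmul z (RtoC (2 * alpha - 1))))))
            (RtoC (2 * alpha * (2 * alpha - 1))).

Definition hrot (phi : R) (h : Cx -> Cx) (z : Cx) : Cx :=
  Cmul (Cexpi (- phi)) (h (Cmul (Cexpi phi) z)).
Definition grot (phi psi : R) (g : Cx -> Cx) (z : Cx) : Cx :=
  Cmul (Cexpi psi) (g (Cmul (Cexpi phi) z)).

(* Main.v *)
From Stdlib Require Import Reals Lra Lia.
From Coquelicot Require Import Rcomplements Rbar Hierarchy Continuity Derive RInt RInt_analysis
  Lim_seq Series PSeries ElemFct AutoDerive.
From Coquelicot Require Complex.
Require Import Defs.
Open Scope R_scope.

(** Let [c_k] be the coefficients of [h'] and [beta = 1 - alpha]. Since [Re (z h'' / h') > - beta],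
    the function [F = z h'' + 2 beta h'] has no zero and [|z h''| <= |F|]. Clunie's method compares
    mean squares over circles of the Taylor polynomials of [h''] and [F] and gives
    [sum_(k <= n) ((k + 1) |c_(k+1)|)^2 <= sum_(k <= n) ((k + 2 beta) |c_k|)^2]. The numbers
    [(k + 1) A_(k+1)] satisfy [(k + 1) y_(k+1) = (k + 2 beta) y_k], hence turn these inequalities
    into equalities, and they dominate [|c_k|] by induction. The coefficients of [g] come from
    [n b_n = e^(i theta) (n - 1) a_(n-1)], and [(1 - z) h'' = 2 beta h'] determines the extremal
    coefficients.

    The quotient [h'' / F] is never expanded in a power series: the means only require the mean
    value property of functions with a continuous complex derivative. *)

(** * The field of complex numbers *)

Lemma Cx_eq (z w : Cx) : re z = re w -> im z = im w -> z = w.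
Proof. destruct z, w; simpl; congruence. Qed.

Lemma Cx_neq0 (z : Cx) : z <> C0 -> re z ^ 2 + im z ^ 2 <> 0.
Proof. intros H E; apply H, Cx_eq; simpl; nra. Qed.

Lemma Cx_field : field_theory C0 C1 Cadd Cmul Csub Copp Cdiv Cinv (@eq Cx).
Proof.
  constructor.
  - constructor; intros; apply Cx_eq; simpl; ring.
  - intros E; apply (f_equal re) in E; simpl in E; lra.
  - reflexivity.
  - intros z Hz; apply Cx_neq0 in Hz.
    apply Cx_eq; unfold Cmul, Cinv, C1, RtoC; cbn [re im]; field; exact Hz.
Qed.

Add Field Cx_field_inst : Cx_field.

Lemma Csub_eq0 (z w : Cx) : Csub z w = C0 -> z = w.
Proof.
  intros E; transitivity (Cadd (Csub z w) w); [ring|rewrite E; ring].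
Qed.

Lemma Cmul_neq0 (z w : Cx) : z <> C0 -> w <> C0 -> Cmul z w <> C0.
Proof.
  intros Hz Hw E; apply Hw.
  transitivity (Cmul (Cinv z) (Cmul z w)); [field; exact Hz|rewrite E; ring].
Qed.

Lemma Cmul_inv_r (z : Cx) : z <> C0 -> Cmul z (Cinv z) = C1.
Proof. intros z_neq0; field; exact z_neq0. Qed.

Lemma Cmul_inv_l (z : Cx) : z <> C0 -> Cmul (Cinv z) z = C1.
Proof. intros z_neq0; field; exact z_neq0. Qed.

Lemma RtoC_neq0 (x : R) : x <> 0 -> RtoC x <> C0.
Proof. intros H E; apply H; injection E; auto. Qed.

Lemma RtoC_add (x y : R) : RtoC (x + y) = Cadd (RtoC x) (RtoC y).
Proof. apply Cx_eq; simpl; ring. Qed.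

Lemma RtoC_mul (x y : R) : RtoC (x * y) = Cmul (RtoC x) (RtoC y).
Proof. apply Cx_eq; simpl; ring. Qed.

Lemma RtoC_S (n : nat) : RtoC (INR (S n)) = Cadd (RtoC (INR n)) C1.
Proof. now rewrite S_INR, RtoC_add. Qed.

(** * Modulus *)

Lemma Cnorm_ge0 (z : Cx) : 0 <= Cnorm z.
Proof. apply sqrt_pos. Qed.

Lemma Cnorm_sqr (z : Cx) : Cnorm z ^ 2 = re z ^ 2 + im z ^ 2.
Proof. apply pow2_sqrt; nra. Qed.

Lemma Cnorm_mul (z w : Cx) : Cnorm (Cmul z w) = Cnorm z * Cnorm w.
Proof. exact (Complex.Cmod_mult (re z, im z) (re w, im w)). Qed.

Lemma Cnorm_add (z w : Cx) : Cnorm (Cadd z w) <= Cnorm z + Cnorm w.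
Proof. exact (Complex.Cmod_triangle (re z, im z) (re w, im w)). Qed.

Lemma Cnorm_RtoC (x : R) : Cnorm (RtoC x) = Rabs x.
Proof. exact (Complex.Cmod_R x). Qed.

Lemma Cnorm_C0 : Cnorm C0 = 0.
Proof. exact Complex.Cmod_0. Qed.

Lemma Cnorm_C1 : Cnorm C1 = 1.
Proof. exact Complex.Cmod_1. Qed.

Lemma Cnorm_opp (z : Cx) : Cnorm (Copp z) = Cnorm z.
Proof. exact (Complex.Cmod_opp (re z, im z)). Qed.

Lemma Cnorm_eq0 (z : Cx) : Cnorm z = 0 -> z = C0.
Proof.
  intros H; pose proof (Cnorm_sqr z) as E; rewrite H in E.
  apply Cx_eq; simpl; nra.
Qed.

Lemma Cnorm_gt0 (z : Cx) : z <> C0 -> 0 < Cnorm z.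
Proof.
  intros H; destruct (Cnorm_ge0 z) as [Hpos|Hzero]; auto.
  now elim H; apply Cnorm_eq0.
Qed.

Lemma Cnorm_neq0 (z : Cx) : 0 < Cnorm z -> z <> C0.
Proof. intros H ->; rewrite Cnorm_C0 in H; lra. Qed.

Lemma Cnorm_inv (z : Cx) : z <> C0 -> Cnorm (Cinv z) = / Cnorm z.
Proof.
  intros H; pose proof (Cnorm_gt0 z H).
  apply Rmult_eq_reg_l with (Cnorm z); [|lra].
  rewrite <- Cnorm_mul, Rinv_r by lra.
  rewrite Cmul_inv_r by exact H; apply Cnorm_C1.
Qed.

Lemma Cnorm_pow (z : Cx) (n : nat) : Cnorm (Cpow z n) = Cnorm z ^ n.
Proof.
  induction n as [|n IH]; simpl; [apply Cnorm_C1|].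
  now rewrite Cnorm_mul, IH.
Qed.

Lemma Cnorm_Cexpi (t : R) : Cnorm (Cexpi t) = 1.
Proof.
  unfold Cnorm, Cexpi; cbn [re im].
  rewrite <- !Rsqr_pow2, Rplus_comm, sin2_cos2; apply sqrt_1.
Qed.

Lemma Rabs_re_le (z : Cx) : Rabs (re z) <= Cnorm z.
Proof. rewrite <- sqrt_Rsqr_abs; apply sqrt_le_1_alt; unfold Rsqr; nra. Qed.

Lemma Rabs_im_le (z : Cx) : Rabs (im z) <= Cnorm z.
Proof. rewrite <- sqrt_Rsqr_abs; apply sqrt_le_1_alt; unfold Rsqr; nra. Qed.

Lemma Cnorm_le_abs (z : Cx) : Cnorm z <= Rabs (re z) + Rabs (im z).
Proof.
  pose proof (Rabs_pos (re z)); pose proof (Rabs_pos (im z)).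
  rewrite <- (sqrt_Rsqr (Rabs (re z) + Rabs (im z))) by lra.
  apply sqrt_le_1_alt.
  rewrite <- (pow2_abs (re z)), <- (pow2_abs (im z)); unfold Rsqr; nra.
Qed.

Lemma inD_C0 : inD C0.
Proof. unfold inD; rewrite Cnorm_C0; lra. Qed.

(** * The complex numbers as a normed field *)

Lemma Cadd_comm (x y : Cx) : Cadd x y = Cadd y x.
Proof. ring. Qed.

Lemma Cadd_assoc (x y z : Cx) : Cadd x (Cadd y z) = Cadd (Cadd x y) z.
Proof. ring. Qed.

Lemma Cadd_0_r (x : Cx) : Cadd x C0 = x.
Proof. ring. Qed.

Lemma Cadd_opp_r (x : Cx) : Cadd x (Copp x) = C0.
Proof. ring. Qed.

Lemma Cmul_comm (x y : Cx) : Cmul x y = Cmul y x.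
Proof. ring. Qed.

Lemma Cmul_assoc (x y z : Cx) : Cmul x (Cmul y z) = Cmul (Cmul x y) z.
Proof. ring. Qed.

Lemma Cmul_1_r (x : Cx) : Cmul x C1 = x.
Proof. ring. Qed.

Lemma Cmul_1_l (x : Cx) : Cmul C1 x = x.
Proof. ring. Qed.

Lemma Cmul_add_distr_r (x y z : Cx) : Cmul (Cadd x y) z = Cadd (Cmul x z) (Cmul y z).
Proof. ring. Qed.

Lemma Cmul_add_distr_l (x y z : Cx) : Cmul x (Cadd y z) = Cadd (Cmul x y) (Cmul x z).
Proof. ring. Qed.

Lemma Cnorm_opp_C1 : Cnorm (Copp C1) = 1.
Proof. rewrite Cnorm_opp; exact Cnorm_C1. Qed.

Lemma Cnorm_mul_le (z w : Cx) : Cnorm (Cmul z w) <= Cnorm z * Cnorm w.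
Proof. apply Req_le, Cnorm_mul. Qed.

Definition Cx_AbelianMonoid_mixin : AbelianMonoid.mixin_of Cx :=
  AbelianMonoid.Mixin Cx Cadd C0 Cadd_comm Cadd_assoc Cadd_0_r.
Canonical Cx_AbelianMonoid : AbelianMonoid :=
  AbelianMonoid.Pack Cx Cx_AbelianMonoid_mixin Cx.

Definition Cx_AbelianGroup_mixin : AbelianGroup.mixin_of Cx_AbelianMonoid :=
  AbelianGroup.Mixin Cx_AbelianMonoid Copp Cadd_opp_r.
Canonical Cx_AbelianGroup : AbelianGroup :=
  AbelianGroup.Pack Cx (AbelianGroup.Class Cx Cx_AbelianMonoid_mixin Cx_AbelianGroup_mixin) Cx.

Definition Cx_Ring_mixin : Ring.mixin_of Cx_AbelianGroup :=
  Ring.Mixin Cx_AbelianGroup Cmul C1 Cmul_assoc Cmul_1_r Cmul_1_l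
    Cmul_add_distr_r Cmul_add_distr_l.
Canonical Cx_Ring : Ring := Ring.Pack Cx (Ring.Class Cx _ Cx_Ring_mixin) Cx.

Definition Cx_AbsRing_mixin : AbsRing.mixin_of Cx_Ring :=
  AbsRing.Mixin Cx_Ring Cnorm Cnorm_C0 Cnorm_opp_C1 Cnorm_add Cnorm_mul_le Cnorm_eq0.
Canonical Cx_AbsRing : AbsRing := AbsRing.Pack Cx (AbsRing.Class Cx _ Cx_AbsRing_mixin) Cx.

Canonical Cx_UniformSpace : UniformSpace :=
  UniformSpace.Pack Cx (UniformSpace.class (AbsRing_UniformSpace Cx_AbsRing)) Cx.
Canonical Cx_ModuleSpace : ModuleSpace Cx_Ring :=
  ModuleSpace.Pack Cx_Ring Cx (ModuleSpace.class Cx_Ring (AbsRing_ModuleSpace Cx_AbsRing)) Cx.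
Canonical Cx_NormedModule : NormedModule Cx_AbsRing :=
  NormedModule.Pack Cx_AbsRing Cx
    (NormedModule.class Cx_AbsRing (AbsRing_NormedModule Cx_AbsRing)) Cx.

(** * Continuity *)

Lemma filterlim_Cnorm {T : Type} {F : (T -> Prop) -> Prop} {FF : Filter F} (f : T -> Cx) (z : Cx) :
  filterlim f F (locally z) <-> forall eps : posreal, F (fun x => Cnorm (Csub (f x) z) < eps).
Proof. exact (filterlim_locally f z). Qed.

Lemma filterlim_mkC {T : Type} {F : (T -> Prop) -> Prop} {FF : Filter F} (f g : T -> R) (x y : R) :
  filterlim f F (locally x) -> filterlim g F (locally y) ->
  filterlim (fun t => mkC (f t) (g t)) F (locally (mkC x y)).
Proof.
  intros Hf Hg; apply filterlim_Cnorm; intros eps.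
  pose proof (proj1 (filterlim_locally f x) Hf (pos_div_2 eps)) as Nf.
  pose proof (proj1 (filterlim_locally g y) Hg (pos_div_2 eps)) as Ng.
  apply (filter_imp _ _) with (2 := filter_and _ _ Nf Ng); intros t [Bf Bg].
  change (Rabs (f t - x) < eps / 2) in Bf; change (Rabs (g t - y) < eps / 2) in Bg.
  eapply Rle_lt_trans; [apply Cnorm_le_abs|].
  change (Rabs (f t - x) + Rabs (g t - y) < eps); lra.
Qed.

Lemma continuous_re (z : Cx) : continuous re z.
Proof.
  apply filterlim_locally; intros eps; exists eps; intros w Hw.
  exact (Rle_lt_trans _ _ _ (Rabs_re_le (Csub w z)) Hw).
Qed.

Lemma continuous_im (z : Cx) : continuous im z.
Proof.
  apply filterlim_locally; intros eps; exists eps; intros w Hw.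
  exact (Rle_lt_trans _ _ _ (Rabs_im_le (Csub w z)) Hw).
Qed.

Lemma continuous_Cnorm (z : Cx) : continuous Cnorm z.
Proof. exact (filterlim_norm (V := Cx_NormedModule) z). Qed.

Section Continuity.

Context {U : UniformSpace}.
Implicit Types (f g : U -> Cx) (x : U).

Lemma continuous_mkC (f g : U -> R) (x : U) :
  continuous f x -> continuous g x -> continuous (fun y => mkC (f y) (g y)) x.
Proof. apply filterlim_mkC. Qed.

Lemma continuous_re_comp f x : continuous f x -> continuous (fun y => re (f y)) x.
Proof. intros Hf; apply (continuous_comp f re x Hf), continuous_re. Qed.

Lemma continuous_im_comp f x : continuous f x -> continuous (fun y => im (f y)) x.
Proof. intros Hf; apply (continuous_comp f im x Hf), continuous_im. Qed.

Lemma continuous_Cnorm_comp f x : continuous f x -> continuous (fun y => Cnorm (f y)) x.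
Proof. intros Hf; apply (continuous_comp f Cnorm x Hf), continuous_Cnorm. Qed.

Lemma continuous_Cadd f g x :
  continuous f x -> continuous g x -> continuous (fun y => Cadd (f y) (g y)) x.
Proof. exact (continuous_plus f g x). Qed.

Lemma continuous_Copp f x : continuous f x -> continuous (fun y => Copp (f y)) x.
Proof. exact (continuous_opp f x). Qed.

Lemma continuous_Cmul f g x :
  continuous f x -> continuous g x -> continuous (fun y => Cmul (f y) (g y)) x.
Proof. exact (continuous_mult f g x). Qed.

Lemma continuous_Rdiv (f g : U -> R) (x : U) :
  g x <> 0 -> continuous f x -> continuous g x -> continuous (fun y => f y / g y) x.
Proof.
  intros gx_neq0 Hf Hg; apply (continuous_mult (K := R_AbsRing)); auto.
  now apply (continuous_comp g Rinv); [|apply continuous_Rinv].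
Qed.

Lemma continuous_Cinv f x :
  f x <> C0 -> continuous f x -> continuous (fun y => Cinv (f y)) x.
Proof.
  intros fx_neq0 Hf; pose proof (continuous_re_comp f x Hf) as Hre.
  pose proof (continuous_im_comp f x Hf) as Him.
  assert (Hsqr : continuous (fun y => re (f y) ^ 2 + im (f y) ^ 2) x).
  { apply (continuous_ext (fun y => Cnorm (f y) * Cnorm (f y))).
    - intros y; rewrite <- Cnorm_sqr; change (Cnorm (f y) * Cnorm (f y) = Cnorm (f y) ^ 2); ring.
    - now apply (continuous_mult (K := R_AbsRing)); apply continuous_Cnorm_comp. }
  apply continuous_mkC; apply continuous_Rdiv; auto using Cx_neq0.
  now apply (continuous_opp (V := R_NormedModule)).
Qed.

Lemma locally_neq0 f x : continuous f x -> f x <> C0 -> locally x (fun y => f y <> C0).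
Proof.
  intros Hf fx_neq0.
  pose proof (proj1 (filterlim_Cnorm f (f x)) Hf (mkposreal _ (Cnorm_gt0 _ fx_neq0))) as Near.
  apply (filter_imp _ _) with (2 := Near); intros y Hy fy_eq0; rewrite fy_eq0 in Hy.
  replace (Csub C0 (f x)) with (Copp (f x)) in Hy by ring.
  rewrite Cnorm_opp in Hy; simpl in Hy; lra.
Qed.

End Continuity.

(** * Complex derivatives *)

Lemma is_derive_of_slope {K : AbsRing} {V : NormedModule K} (f phi : K -> V) (x : K) :
  locally x (fun y => minus (f y) (f x) = scal (minus y x) (phi y)) ->
  continuous phi x -> is_derive f x (phi x).
Proof.
  intros Hslope Hphi; split; [apply is_linear_scal_l|].
  intros x' Hx' eps.
  rewrite <- (is_filter_lim_locally_unique x x' Hx').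
  pose proof (proj1 (filterlim_locally_ball_norm phi (phi x)) Hphi eps) as Near.
  apply (filter_imp _ _) with (2 := filter_and _ _ Hslope Near); intros y [-> Hy].
  change (norm (minus (scal (minus y x) (phi y)) (scal (minus y x) (phi x)))
          <= eps * abs (minus y x)).
  rewrite <- scal_minus_distr_l.
  eapply Rle_trans; [apply norm_scal|].
  rewrite Rmult_comm; apply Rmult_le_compat_r; [apply abs_ge_0|now apply Rlt_le].
Qed.

Section Slope.

Context {K : AbsRing} {V : NormedModule K}.
Variable inv : K -> K.
Hypothesis mult_inv_l : forall x : K, x <> zero -> mult (inv x) x = one.
Hypothesis mult_inv_r : forall x : K, x <> zero -> mult x (inv x) = one.
Hypothesis abs_inv : forall x : K, x <> zero -> abs (inv x) = / abs x.

Definition slope (f : K -> V) (x : K) (l : V) (y : K) : V :=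
  if Req_EM_T (abs (minus y x)) 0 then l else scal (inv (minus y x)) (minus (f y) (f x)).

Lemma slope_diag (f : K -> V) (x : K) (l : V) : slope f x l x = l.
Proof.
  unfold slope; destruct Req_EM_T as [|Hxx]; auto.
  elim Hxx; rewrite minus_eq_zero; exact abs_zero.
Qed.

Lemma slopeE (f : K -> V) (x : K) (l : V) (y : K) :
  minus (f y) (f x) = scal (minus y x) (slope f x l y).
Proof.
  unfold slope; destruct Req_EM_T as [Hyx|Hyx].
  - apply abs_eq_zero in Hyx; assert (Eyx : y = x).
    { apply (plus_reg_r (opp x)); exact (eq_trans Hyx (eq_sym (plus_opp_r x))). }
    rewrite Eyx, !minus_eq_zero; symmetry; exact (scal_zero_l l).
  - rewrite scal_assoc, mult_inv_r; [now rewrite scal_one|].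
    intros E; apply Hyx; rewrite E; exact abs_zero.
Qed.

Lemma continuous_slope (f : K -> V) (x : K) (l : V) :
  is_derive f x l -> continuous (slope f x l) x.
Proof.
  intros Hf; apply filterlim_locally_ball_norm; intros eps; rewrite slope_diag.
  pose proof (proj2 Hf x (fun P HP => HP) (pos_div_2 eps)) as Near.
  apply (filter_imp _ _) with (2 := Near); intros y Hy; unfold ball_norm; clear Near.
  destruct (Req_EM_T (abs (minus y x)) 0) as [Hyx|Hyx].
  - unfold slope; destruct Req_EM_T; [|contradiction].
    rewrite minus_eq_zero; eapply Rle_lt_trans; [right; exact norm_zero|apply cond_pos].
  - assert (yx_neq0 : minus y x <> zero) by (intros E; apply Hyx; rewrite E; exact abs_zero).
    rewrite (slopeE f x l y) in Hy.
    change (norm (minus (scal (minus y x) (slope f x l y)) (scal (minus y x) l))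
            <= pos_div_2 eps * abs (minus y x)) in Hy.
    rewrite <- scal_minus_distr_l in Hy.
    rewrite <- (scal_one (minus (slope f x l y) l)), <- (mult_inv_l (minus y x)), <- scal_assoc
      by exact yx_neq0.
    eapply Rle_lt_trans; [apply norm_scal|]; rewrite abs_inv by exact yx_neq0.
    eapply Rle_lt_trans; [apply Rmult_le_compat_l; [|exact Hy]|].
    + apply Rlt_le, Rinv_0_lt_compat; pose proof (abs_ge_0 (minus y x)); lra.
    + apply Rle_lt_trans with (eps / 2); [right; simpl; field; auto|].
      pose proof (cond_pos eps); lra.
Qed.

Lemma is_derive_slope (f : K -> V) (x : K) (l : V) :
  is_derive f x l ->
  exists phi : K -> V, continuous phi x /\ phi x = l /\
    forall y, minus (f y) (f x) = scal (minus y x) (phi y).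
Proof.
  intros Hf; exists (slope f x l); split; [now apply continuous_slope|].
  split; [apply slope_diag|apply slopeE].
Qed.

End Slope.

Lemma is_derive_slope_R (f : R -> R) (x l : R) :
  is_derive f x l ->
  exists phi : R -> R, continuous phi x /\ phi x = l /\
    forall y, f y - f x = (y - x) * phi y.
Proof.
  apply (is_derive_slope (K := R_AbsRing) (V := R_NormedModule) Rinv).
  - exact Rinv_l.
  - exact Rinv_r.
  - intros y _; apply Rabs_inv.
Qed.

Lemma is_derive_slope_Cx (f : Cx -> Cx) (z l : Cx) :
  is_derive f z l ->
  exists phi : Cx -> Cx, continuous phi z /\ phi z = l /\
    forall w, Csub (f w) (f z) = Cmul (Csub w z) (phi w).
Proof.
  exact (is_derive_slope (K := Cx_AbsRing) (V := Cx_NormedModule)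
           Cinv Cmul_inv_l Cmul_inv_r Cnorm_inv f z l).
Qed.

Lemma is_derive_Cx_of_slope (f phi : Cx -> Cx) (z : Cx) :
  locally z (fun w => Csub (f w) (f z) = Cmul (Csub w z) (phi w)) ->
  continuous phi z -> is_derive f z (phi z).
Proof. exact (is_derive_of_slope (K := Cx_AbsRing) (V := Cx_NormedModule) f phi z). Qed.

Lemma Cderiv_at_is_derive (f : Cx -> Cx) (z l : Cx) : Cderiv_at f z l <-> is_derive f z l.
Proof.
  split.
  - intros Hf; set (phi := slope (K := Cx_AbsRing) (V := Cx_NormedModule) Cinv f z l).
    assert (phi_z : phi z = l) by apply slope_diag.
    rewrite <- phi_z; apply is_derive_Cx_of_slope.
    + apply filter_forall; intros w; exact (slopeE Cinv Cmul_inv_r f z l w).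
    + apply filterlim_Cnorm; rewrite phi_z; intros eps.
      destruct (Hf eps (cond_pos eps)) as [d [d_pos Hd]].
      exists (mkposreal d d_pos); intros w Hw; unfold phi, slope; destruct Req_EM_T as [E|Hwz].
      * replace (Csub l l) with C0 by ring; rewrite Cnorm_C0; apply cond_pos.
      * change (Cnorm (Csub (Cmul (Cinv (Csub w z)) (Csub (f w) (f z))) l) < eps).
        rewrite Cmul_comm; apply Hd; split; [|exact Hw].
        change (Cnorm (Csub w z) <> 0) in Hwz; pose proof (Cnorm_ge0 (Csub w z)); lra.
  - intros Hf eps eps_pos; destruct (is_derive_slope_Cx f z l Hf) as [phi [Hphi [<- E]]].
    destruct (proj1 (filterlim_Cnorm phi (phi z)) Hphi (mkposreal eps eps_pos)) as [d Hd].
    exists d; split; [apply cond_pos|]; intros w [wz_pos Hw].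
    replace (Cdiv (Csub (f w) (f z)) (Csub w z)) with (phi w); [exact (Hd w Hw)|].
    rewrite E; field; now apply Cnorm_neq0.
Qed.

Lemma is_derive_Cx_continuous (f : Cx -> Cx) (z l : Cx) : is_derive f z l -> continuous f z.
Proof. intros H; exact (ex_derive_continuous f z (ex_intro _ l H)). Qed.

Lemma is_derive_Cx_eq (f : Cx -> Cx) (z l m : Cx) : is_derive f z l -> l = m -> is_derive f z m.
Proof. now intros H <-. Qed.

Lemma is_derive_Cadd (f g : Cx -> Cx) (z l m : Cx) :
  is_derive f z l -> is_derive g z m ->
  is_derive (fun w => Cadd (f w) (g w)) z (Cadd l m).
Proof. exact (is_derive_plus f g z l m). Qed.

Lemma is_derive_Copp (f : Cx -> Cx) (z l : Cx) :
  is_derive f z l -> is_derive (fun w => Copp (f w)) z (Copp l).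
Proof. exact (is_derive_opp f z l). Qed.

Lemma is_derive_Csub (f g : Cx -> Cx) (z l m : Cx) :
  is_derive f z l -> is_derive g z m ->
  is_derive (fun w => Csub (f w) (g w)) z (Csub l m).
Proof. exact (is_derive_minus f g z l m). Qed.

Lemma is_derive_Cmul (f g : Cx -> Cx) (z l m : Cx) :
  is_derive f z l -> is_derive g z m ->
  is_derive (fun w => Cmul (f w) (g w)) z (Cadd (Cmul l (g z)) (Cmul (f z) m)).
Proof. intros Hf Hg; exact (is_derive_mult f g z l m Hf Hg Cmul_comm). Qed.

Lemma is_derive_Cmul_const (c : Cx) (f : Cx -> Cx) (z l : Cx) :
  is_derive f z l -> is_derive (fun w => Cmul c (f w)) z (Cmul c l).
Proof.
  intros Hf; eapply is_derive_Cx_eq; [apply is_derive_Cmul; [apply is_derive_const|exact Hf]|].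
  change (Cadd (Cmul C0 (f z)) (Cmul c l) = Cmul c l); ring.
Qed.

Lemma is_derive_Cx_comp (f g : Cx -> Cx) (z l m : Cx) :
  is_derive f (g z) l -> is_derive g z m -> is_derive (fun w => f (g w)) z (Cmul m l).
Proof. exact (is_derive_comp f g z l m). Qed.

Lemma is_derive_Cinv (f : Cx -> Cx) (z l : Cx) :
  f z <> C0 -> is_derive f z l ->
  is_derive (fun w => Cinv (f w)) z (Copp (Cdiv l (Cmul (f z) (f z)))).
Proof.
  intros fz_neq0 Hf.
  assert (D : is_derive Cinv (f z) (Copp (Cinv (Cmul (f z) (f z))))).
  { apply (is_derive_Cx_of_slope Cinv (fun w => Copp (Cinv (Cmul w (f z))))).
    - apply (filter_imp _ _)
        with (2 := locally_neq0 (fun w => w) (f z) (continuous_id (f z)) fz_neq0).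
      intros w w_neq0; field; auto.
    - apply continuous_Copp, continuous_Cinv; [now apply Cmul_neq0|].
      apply continuous_Cmul; [apply continuous_id|apply continuous_const]. }
  eapply is_derive_Cx_eq; [exact (is_derive_Cx_comp Cinv f z _ _ D Hf)|field; auto].
Qed.

Lemma is_derive_Cdiv (f g : Cx -> Cx) (z l m : Cx) :
  g z <> C0 -> is_derive f z l -> is_derive g z m ->
  is_derive (fun w => Cdiv (f w) (g w)) z
    (Cdiv (Csub (Cmul l (g z)) (Cmul (f z) m)) (Cmul (g z) (g z))).
Proof.
  intros gz_neq0 Hf Hg.
  eapply is_derive_Cx_eq.
  - apply is_derive_Cmul; [exact Hf|exact (is_derive_Cinv g z m gz_neq0 Hg)].
  - cbv beta; field; auto.
Qed.

Lemma is_derive_inverse_function (f g : Cx -> Cx) (z l : Cx) :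
  locally z (fun w => f (g w) = w) -> continuous g z -> is_derive f (g z) l -> l <> C0 ->
  is_derive g z (Cinv l).
Proof.
  intros Hfg Hg Hf l_neq0.
  destruct (is_derive_slope_Cx f (g z) l Hf) as [phi [Hphi [<- E]]].
  assert (Hphi_g : continuous (fun w => phi (g w)) z) by now apply continuous_comp.
  apply (is_derive_Cx_of_slope g (fun w => Cinv (phi (g w)))); [|now apply continuous_Cinv].
  apply (filter_imp _ _) with (2 := filter_and _ _ Hfg (locally_neq0 _ z Hphi_g l_neq0)).
  intros w [Hw phi_neq0]; specialize (E (g w)).
  rewrite Hw, (locally_singleton z _ Hfg) in E; rewrite E; field; exact phi_neq0.
Qed.

Lemma is_derive_Cx_unique (f : Cx -> Cx) (z l m : Cx) :
  is_derive f z l -> is_derive f z m -> l = m.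
Proof.
  intros Hl Hm; apply Csub_eq0, Cnorm_eq0.
  destruct (Req_dec (Cnorm (Csub l m)) 0) as [|Hneq]; auto; exfalso.
  destruct (is_derive_slope_Cx _ z _ (is_derive_Csub f f z l m Hl Hm)) as [phi [Hphi [phi_z E]]].
  assert (phi_z_neq0 : phi z <> C0)
    by (rewrite phi_z; intros Elm; apply Hneq; rewrite Elm; apply Cnorm_C0).
  destruct (locally_neq0 phi z Hphi phi_z_neq0) as [d Hd].
  set (v := RtoC (d / 2)); pose proof (cond_pos d) as d_pos.
  assert (v_neq0 : v <> C0) by (apply RtoC_neq0; lra).
  apply (Hd (Cadd z v)).
  - change (Cnorm (Csub (Cadd z v) z) < d); replace (Csub (Cadd z v) z) with v by ring.
    unfold v; rewrite Cnorm_RtoC, Rabs_pos_eq; lra.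
  - specialize (E (Cadd z v)); replace (Csub (Cadd z v) z) with v in E by ring.
    transitivity (Cmul (Cinv v) (Cmul v (phi (Cadd z v)))); [field; exact v_neq0|].
    rewrite <- E; ring.
Qed.

Lemma is_derive_re_curve (f : Cx -> Cx) (x y : R -> R) (t dx dy : R) (l : Cx) :
  is_derive f (mkC (x t) (y t)) l -> is_derive x t dx -> is_derive y t dy ->
  is_derive (fun s => re (f (mkC (x s) (y s)))) t (re (Cmul (mkC dx dy) l)).
Proof.
  intros Hf Hx Hy.
  destruct (is_derive_slope_Cx _ _ _ Hf) as [phi [Hphi [<- Ef]]].
  destruct (is_derive_slope_R _ _ _ Hx) as [xi [Hxi [<- Ex]]].
  destruct (is_derive_slope_R _ _ _ Hy) as [eta [Heta [<- Ey]]].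
  assert (Hcurve : continuous (fun s => mkC (x s) (y s)) t).
  { apply continuous_mkC; apply (ex_derive_continuous (V := R_NormedModule)); eexists; eauto. }
  apply (is_derive_of_slope (K := R_AbsRing) (V := R_NormedModule) _
           (fun s => re (Cmul (mkC (xi s) (eta s)) (phi (mkC (x s) (y s)))))).
  - apply filter_forall; intros s; specialize (Ef (mkC (x s) (y s))).
    change (Csub (mkC (x s) (y s)) (mkC (x t) (y t))) with (mkC (x s - x t) (y s - y t)) in Ef.
    rewrite Ex, Ey in Ef; apply (f_equal re) in Ef; simpl in Ef.
    change (re (f (mkC (x s) (y s))) - re (f (mkC (x t) (y t))) =
            (s - t) * re (Cmul (mkC (xi s) (eta s)) (phi (mkC (x s) (y s))))).
    unfold Rminus at 1; rewrite Ef; simpl; ring.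
  - apply continuous_re_comp, continuous_Cmul; [now apply continuous_mkC|].
    now apply (continuous_comp (fun s => mkC (x s) (y s)) phi).
Qed.

Lemma norm_minus_R2 (p q : R * R) :
  norm (@minus (prod_NormedModule R_AbsRing R_NormedModule R_NormedModule) p q) =
  Cnorm (Csub (mkC (fst p) (snd p)) (mkC (fst q) (snd q))).
Proof.
  unfold Cnorm, norm; simpl; unfold prod_norm; simpl.
  rewrite !Rmult_1_r, <- !Rabs_mult, !Rabs_pos_eq by apply Rle_0_sqr; reflexivity.
Qed.

Lemma is_derive_cauchy_riemann (f : Cx -> Cx) (z : Cx) (a b : R) :
  filterdiff (fun p : R * R => re (f (mkC (fst p) (snd p)))) (locally (re z, im z))
    (fun p => a * fst p - b * snd p) ->
  filterdiff (fun p : R * R => im (f (mkC (fst p) (snd p)))) (locally (re z, im z))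
    (fun p => b * fst p + a * snd p) ->
  is_derive f z (mkC a b).
Proof.
  intros [_ Hre] [_ Him]; split; [apply is_linear_scal_l|].
  intros z' Hz' eps; rewrite <- (is_filter_lim_locally_unique z z' Hz'); clear z' Hz'.
  destruct (filter_and _ _ (Hre _ (fun P HP => HP) (pos_div_2 eps))
                           (Him _ (fun P HP => HP) (pos_div_2 eps))) as [d Hd].
  exists d; intros w Hw; destruct w as [x y], z as [x0 y0]; cbn [re im] in *.
  set (D := Cnorm (Csub (mkC x y) (mkC x0 y0))).
  assert (B : ball (x0, y0) d (x, y)).
  { split; (eapply Rle_lt_trans; [|exact Hw]);
      [apply (Rabs_re_le (Csub (mkC x y) (mkC x0 y0)))
      |apply (Rabs_im_le (Csub (mkC x y) (mkC x0 y0)))]. }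
  destruct (Hd _ B) as [Bre Bim]; rewrite norm_minus_R2 in Bre, Bim.
  set (E := Csub (Csub (f (mkC x y)) (f (mkC x0 y0)))
                 (Cmul (Csub (mkC x y) (mkC x0 y0)) (mkC a b))).
  change (Rabs (re (f (mkC x y)) - re (f (mkC x0 y0)) - (a * (x - x0) - b * (y - y0)))
          <= eps / 2 * D) in Bre.
  change (Rabs (im (f (mkC x y)) - im (f (mkC x0 y0)) - (b * (x - x0) + a * (y - y0)))
          <= eps / 2 * D) in Bim.
  change (Cnorm E <= eps * D); eapply Rle_trans; [apply Cnorm_le_abs|].
  replace (re E) with (re (f (mkC x y)) - re (f (mkC x0 y0)) - (a * (x - x0) - b * (y - y0)))
    by (simpl; ring).
  replace (im E) with (im (f (mkC x y)) - im (f (mkC x0 y0)) - (b * (x - x0) + a * (y - y0)))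
    by (simpl; ring).
  lra.
Qed.

(** * Series of complex numbers *)

Lemma sum_n_mkC (u : nat -> Cx) (N : nat) :
  sum_n u N = mkC (sum_n (fun k => re (u k)) N) (sum_n (fun k => im (u k)) N).
Proof.
  induction N as [|N IH]; [rewrite !sum_O; now apply Cx_eq|].
  rewrite !sum_Sn, IH; reflexivity.
Qed.

Lemma is_series_re_im (u : nat -> Cx) (s : Cx) :
  is_series (fun k => re (u k)) (re s) -> is_series (fun k => im (u k)) (im s) -> is_series u s.
Proof.
  intros Hre Him; destruct s as [x y].
  apply (filterlim_ext (fun N => mkC (sum_n (fun k => re (u k)) N) (sum_n (fun k => im (u k)) N))).
  - intros N; symmetry; apply sum_n_mkC.
  - now apply filterlim_mkC.
Qed.

Lemma Csum_sum_n (u : nat -> Cx) (N : nat) : Csum u N = sum_n u N.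
Proof.
  induction N as [|N IH]; [now rewrite sum_O|rewrite sum_Sn, <- IH; reflexivity].
Qed.

Lemma has_sum_is_series (u : nat -> Cx) (s : Cx) : has_sum u s -> is_series u s.
Proof.
  intros [Hre Him]; apply is_series_re_im; unfold is_series.
  - apply (is_lim_seq_ext (fun N => re (Csum u N)) _ (re s)); [|now apply is_lim_seq_Reals].
    intros N; now rewrite Csum_sum_n, sum_n_mkC.
  - apply (is_lim_seq_ext (fun N => im (Csum u N)) _ (im s)); [|now apply is_lim_seq_Reals].
    intros N; now rewrite Csum_sum_n, sum_n_mkC.
Qed.

Lemma is_series_Cx_ext (u v : nat -> Cx) (s : Cx) :
  (forall k, u k = v k) -> is_series u s -> is_series v s.
Proof. exact (is_series_ext u v s). Qed.

Lemma is_series_Cx_unique (u : nat -> Cx) (s t : Cx) : is_series u s -> is_series u t -> s = t.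
Proof. exact (filterlim_locally_unique (V := Cx_NormedModule) (sum_n u) s t). Qed.

Lemma is_series_terms_bounded (u : nat -> Cx) (s : Cx) :
  is_series u s -> exists M, forall k, Cnorm (u k) <= M.
Proof.
  intros Hu.
  destruct (filterlim_bounded (V := Cx_NormedModule) (sum_n u) (ex_intro _ s Hu)) as [M HM].
  exists (M + M); intros [|k].
  - specialize (HM 0%nat); rewrite sum_O in HM; change (Cnorm (u 0%nat) <= M) in HM.
    pose proof (Cnorm_ge0 (u 0%nat)); lra.
  - pose proof (HM k) as Bk; pose proof (HM (S k)) as BSk; rewrite sum_Sn in BSk.
    change (Cnorm (sum_n u k) <= M) in Bk; change (Cnorm (Cadd (sum_n u k) (u (S k))) <= M) in BSk.
    replace (u (S k)) with (Cadd (Cadd (sum_n u k) (u (S k))) (Copp (sum_n u k))) by ring.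
    eapply Rle_trans; [apply Cnorm_add|]; rewrite Cnorm_opp; lra.
Qed.

Definition Cx_series (u : nat -> Cx) : Cx :=
  mkC (Series (fun k => re (u k))) (Series (fun k => im (u k))).

Lemma is_series_Cx_series (u : nat -> Cx) (M : nat -> R) :
  ex_series M -> (forall k, Cnorm (u k) <= M k) -> is_series u (Cx_series u).
Proof.
  intros HM Hle; apply is_series_re_im; apply Series_correct;
    apply (ex_series_le (V := R_CompleteNormedModule)) with (2 := HM); intros k;
    (eapply Rle_trans; [|apply Hle]); [apply Rabs_re_le|apply Rabs_im_le].
Qed.

Lemma Cnorm_series_tail (u : nat -> Cx) (s : Cx) (M : nat -> R) (N : nat) :
  is_series u s -> ex_series M -> (forall k, Cnorm (u k) <= M k) ->
  Cnorm (Csub s (sum_n u N)) <= Series M - sum_n M N.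
Proof.
  intros Hu HM Hle.
  apply (filterlim_le (F := eventually) (fun m => Cnorm (Csub (sum_n u m) (sum_n u N)))
           (fun m => sum_n M m - sum_n M N) (Cnorm (Csub s (sum_n u N))) (Series M - sum_n M N)).
  - exists N; intros m Hm; induction Hm as [|m Hm IH].
    + replace (Csub _ _) with C0 by ring; rewrite Cnorm_C0; lra.
    + rewrite !sum_Sn; change (plus (sum_n M m) (M (S m))) with (sum_n M m + M (S m)).
      change (plus (sum_n u m) (u (S m))) with (Cadd (sum_n u m) (u (S m))).
      replace (Csub (Cadd (sum_n u m) (u (S m))) (sum_n u N))
        with (Cadd (Csub (sum_n u m) (sum_n u N)) (u (S m))) by ring.
      eapply Rle_trans; [apply Cnorm_add|]; specialize (Hle (S m)); lra.
  - apply (filterlim_comp _ _ _ (sum_n u) (fun x => Cnorm (Csub x (sum_n u N))) _ _ _ Hu).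
    apply (continuous_Cnorm_comp (fun x => Csub x (sum_n u N))), continuous_Cadd;
      [apply continuous_id|apply continuous_const].
  - apply (is_lim_seq_minus' (sum_n M) (fun _ => sum_n M N)); [|apply is_lim_seq_const].
    exact (Series_correct M HM).
Qed.

Lemma weierstrass_M_test {U : UniformSpace} (u : nat -> U -> Cx) (s : U -> Cx)
  (M : nat -> R) (x : U) :
  ex_series M -> locally x (fun y => forall k, Cnorm (u k y) <= M k) ->
  locally x (fun y => is_series (fun k => u k y) (s y)) ->
  (forall k, continuous (u k) x) -> continuous s x.
Proof.
  intros HM Hle Hs Hu; apply filterlim_Cnorm; intros eps; pose proof (cond_pos eps) as eps_pos.
  assert (eps3_pos : 0 < eps / 3) by lra.
  destruct (proj1 (filterlim_locally _ _) (Series_correct M HM) (mkposreal _ eps3_pos)) as [N HN].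
  specialize (HN N (le_n N)); change (Rabs (sum_n M N - Series M) < eps / 3) in HN.
  apply Rabs_def2 in HN.
  assert (Hsum : continuous (fun y => sum_n (fun k => u k y) N) x).
  { clear HN; induction N as [|N IH].
    - apply (continuous_ext (u 0%nat)); [intros y; now rewrite sum_O|apply Hu].
    - apply (continuous_ext (fun y => Cadd (sum_n (fun k => u k y) N) (u (S N) y)));
        [intros y; now rewrite sum_Sn|now apply continuous_Cadd]. }
  pose proof (proj1 (filterlim_Cnorm _ _) Hsum (mkposreal _ eps3_pos)) as Near.
  assert (Tail : forall y, (forall k, Cnorm (u k y) <= M k) -> is_series (fun k => u k y) (s y) ->
    Cnorm (Csub (s y) (sum_n (fun k => u k y) N)) < eps / 3).
  { intros y Hy Sy; pose proof (Cnorm_series_tail _ _ M N Sy HM Hy); lra. }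
  pose proof (Tail x (locally_singleton _ _ Hle) (locally_singleton _ _ Hs)) as Tail_x.
  apply (filter_imp _ _) with (2 := filter_and _ _ (filter_and _ _ Hle Hs) Near).
  intros y [[Hy Sy] Ny]; specialize (Tail y Hy Sy); simpl in Ny.
  set (sx := sum_n (fun k => u k x) N) in *; set (sy := sum_n (fun k => u k y) N) in *.
  replace (Csub (s y) (s x))
    with (Cadd (Cadd (Csub (s y) sy) (Csub sy sx)) (Copp (Csub (s x) sx))) by ring.
  eapply Rle_lt_trans; [apply Cnorm_add|]; rewrite Cnorm_opp.
  pose proof (Cnorm_add (Csub (s y) sy) (Csub sy sx)); lra.
Qed.

(** * Power series on the unit disc *)

Definition disc_series (a : nat -> Cx) (f : Cx -> Cx) : Prop :=
  forall z, inD z -> is_pseries a z (f z).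

Lemma disc_series_of_has_sum (a : nat -> Cx) (f : Cx -> Cx) :
  (forall z, inD z -> has_sum (fun k => Cmul (a k) (Cpow z k)) (f z)) -> disc_series a f.
Proof.
  intros H z Hz; apply is_series_Cx_ext with (2 := has_sum_is_series _ _ (H z Hz)).
  intros k; apply Cmul_comm.
Qed.

Lemma disc_series_ext (a : nat -> Cx) (f g : Cx -> Cx) :
  (forall z, inD z -> f z = g z) -> disc_series a f -> disc_series a g.
Proof. intros E H z Hz; rewrite <- E by exact Hz; now apply H. Qed.

Lemma disc_series_plus (a b : nat -> Cx) (f g : Cx -> Cx) :
  disc_series a f -> disc_series b g ->
  disc_series (PS_plus a b) (fun z => Cadd (f z) (g z)).
Proof. intros Ha Hb z Hz; exact (is_pseries_plus a b z _ _ (Ha z Hz) (Hb z Hz)). Qed.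

Lemma disc_series_scal (c : Cx) (a : nat -> Cx) (f : Cx -> Cx) :
  disc_series a f -> disc_series (PS_scal c a) (fun z => Cmul c (f z)).
Proof. intros Ha z Hz; exact (is_pseries_scal c a z _ (Cmul_comm z c) (Ha z Hz)). Qed.

Lemma disc_series_incr_1 (a : nat -> Cx) (f : Cx -> Cx) :
  disc_series a f -> disc_series (PS_incr_1 a) (fun z => Cmul z (f z)).
Proof. intros Ha z Hz; exact (is_pseries_incr_1 a z _ (Ha z Hz)). Qed.

Lemma disc_series_at_0 (a : nat -> Cx) (f : Cx -> Cx) : disc_series a f -> f C0 = a 0%nat.
Proof.
  intros H; exact (is_series_Cx_unique _ _ _ (H C0 inD_C0) (is_pseries_0 a)).
Qed.

Lemma disc_series_decr_1 (a : nat -> Cx) (f : Cx -> Cx) :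
  disc_series a f -> exists g, disc_series (PS_decr_1 a) g /\
    forall z, inD z -> f z = Cadd (a 0%nat) (Cmul z (g z)).
Proof.
  intros H.
  exists (fun z => if Req_EM_T (Cnorm z) 0 then a 1%nat else Cdiv (Csub (f z) (a 0%nat)) z).
  split; intros z Hz; destruct Req_EM_T as [E|Hz0].
  - apply Cnorm_eq0 in E; subst z; exact (is_pseries_0 (PS_decr_1 a)).
  - assert (z_neq0 : z <> C0) by (intros ->; apply Hz0, Cnorm_C0).
    replace (Cdiv (Csub (f z) (a 0%nat)) z) with (Cmul (Cinv z) (Csub (f z) (a 0%nat)))
      by (field; exact z_neq0).
    apply (is_pseries_decr_1 a z (Cinv z) (f z)); [|now apply H].
    exact (Cmul_inv_l z z_neq0).
  - apply Cnorm_eq0 in E; subst z; rewrite (disc_series_at_0 a f H); ring.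
  - field; intros ->; apply Hz0, Cnorm_C0.
Qed.

Definition derive_coef (a : nat -> Cx) (k : nat) : Cx := Cmul (RtoC (INR (S k))) (a (S k)).

Lemma Cnorm_derive_coef (a : nat -> Cx) (k : nat) :
  Cnorm (derive_coef a k) = INR (S k) * Cnorm (a (S k)).
Proof.
  unfold derive_coef; rewrite Cnorm_mul, Cnorm_RtoC, Rabs_pos_eq by apply pos_INR; reflexivity.
Qed.

Lemma derive_coef_summable (a : nat -> Cx) (f : Cx -> Cx) (rho : R) :
  disc_series a f -> 0 <= rho < 1 -> ex_series (fun k => Cnorm (derive_coef a k) * rho ^ k).
Proof.
  intros H Hrho; set (b := fun k => Cnorm (a k)); set (s := (1 + rho) / 2).
  assert (Hs : inD (RtoC s)) by (unfold inD; rewrite Cnorm_RtoC, Rabs_pos_eq; unfold s; lra).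
  assert (Hradius : Rbar_lt rho (CV_radius b)).
  { apply Rbar_lt_le_trans with (Finite s); [simpl; unfold s; lra|].
    apply CV_radius_bounded.
    destruct (is_series_terms_bounded _ _ (H _ Hs)) as [M HM]; exists M; intros k.
    specialize (HM k).
    change (scal (pow_n (RtoC s) k) (a k)) with (Cmul (Cpow (RtoC s) k) (a k)) in HM.
    rewrite Cnorm_mul, Cnorm_pow, Cnorm_RtoC, (Rabs_pos_eq s) in HM by (unfold s; lra).
    rewrite Rabs_pos_eq, Rmult_comm; [exact HM|].
    apply Rmult_le_pos; [apply Cnorm_ge0|apply pow_le; unfold s; lra]. }
  rewrite <- CV_radius_derive, <- (Rabs_pos_eq rho) in Hradius by lra.
  apply ex_series_ext with (2 := CV_disk_inside _ _ Hradius); intros k.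
  rewrite Cnorm_derive_coef; unfold PS_derive, b; apply Rabs_pos_eq.
  apply Rmult_le_pos; [apply Rmult_le_pos; [apply pos_INR|apply Cnorm_ge0]|apply pow_le; lra].
Qed.

Fixpoint pow_slope (z : Cx) (k : nat) (w : Cx) : Cx :=
  match k with
  | O => C0
  | S j => Cadd (Cmul w (pow_slope z j w)) (Cpow z j)
  end.

Lemma pow_slopeE (z w : Cx) (k : nat) :
  Csub (Cpow w k) (Cpow z k) = Cmul (Csub w z) (pow_slope z k w).
Proof.
  induction k as [|k IH]; simpl; [ring|].
  transitivity (Cadd (Cmul w (Csub (Cpow w k) (Cpow z k))) (Cmul (Csub w z) (Cpow z k))); [ring|].
  rewrite IH; ring.
Qed.

Lemma pow_slope_diag (z : Cx) (k : nat) :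
  pow_slope z (S k) z = Cmul (RtoC (INR (S k))) (Cpow z k).
Proof.
  induction k as [|k IH]; [simpl; change (RtoC 1) with C1; ring|].
  change (pow_slope z (S (S k)) z) with (Cadd (Cmul z (pow_slope z (S k) z)) (Cpow z (S k))).
  rewrite IH, (RtoC_S (S k)); simpl; ring.
Qed.

Lemma Cnorm_pow_slope_le (z w : Cx) (rho : R) (k : nat) :
  Cnorm z <= rho -> Cnorm w <= rho -> Cnorm (pow_slope z (S k) w) <= INR (S k) * rho ^ k.
Proof.
  intros Hz Hw; pose proof (Cnorm_ge0 z); pose proof (Cnorm_ge0 w).
  assert (Hpow : forall j, Cnorm (Cpow z j) <= rho ^ j)
    by (intros j; rewrite Cnorm_pow; apply pow_incr; lra).
  induction k as [|k IH].
  - simpl; replace (Cadd (Cmul w C0) C1) with C1 by ring; rewrite Cnorm_C1; lra.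
  - change (pow_slope z (S (S k)) w) with (Cadd (Cmul w (pow_slope z (S k) w)) (Cpow z (S k))).
    eapply Rle_trans; [apply Cnorm_add|]; rewrite Cnorm_mul, (S_INR (S k)).
    replace ((INR (S k) + 1) * rho ^ S k) with (rho * (INR (S k) * rho ^ k) + rho ^ S k)
      by (simpl; ring).
    apply Rplus_le_compat; [|apply Hpow].
    apply Rmult_le_compat; auto using Cnorm_ge0.
Qed.

Lemma continuous_pow_slope (z : Cx) (k : nat) (w : Cx) : continuous (pow_slope z k) w.
Proof.
  induction k as [|k IH]; [apply continuous_const|].
  apply (continuous_Cadd (fun w => Cmul w (pow_slope z k w))); [|apply continuous_const].
  apply continuous_Cmul; [apply continuous_id|exact IH].
Qed.

Lemma locally_Cnorm_lt (z : Cx) (r : R) : Cnorm z < r -> locally z (fun w => Cnorm w < r).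
Proof.
  intros Hz; assert (Hpos : 0 < r - Cnorm z) by lra.
  exists (mkposreal _ Hpos); intros w Hw; change (Cnorm (Csub w z) < r - Cnorm z) in Hw.
  replace w with (Cadd (Csub w z) z) by ring; pose proof (Cnorm_add (Csub w z) z); lra.
Qed.

Lemma disc_series_diff (a : nat -> Cx) (f : Cx -> Cx) (z w : Cx) :
  disc_series a f -> inD z -> inD w ->
  is_series (fun k => Cmul (Csub w z) (Cmul (a (S k)) (pow_slope z (S k) w))) (Csub (f w) (f z)).
Proof.
  intros H Hz Hw.
  assert (D : is_series (fun k => Csub (Cmul (Cpow w k) (a k)) (Cmul (Cpow z k) (a k)))
                (Csub (f w) (f z))) by exact (is_series_minus _ _ _ _ (H w Hw) (H z Hz)).
  apply is_series_Cx_ext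
    with (u := fun k => Cmul (a (S k)) (Csub (Cpow w (S k)) (Cpow z (S k)))).
  { intros k; rewrite pow_slopeE; ring. }
  apply (is_series_incr_1 (fun k => Cmul (a k) (Csub (Cpow w k) (Cpow z k)))).
  assert (E : Csub (f w) (f z) = Cadd (Csub (f w) (f z)) (Cmul (a 0%nat) (Csub C1 C1))) by ring.
  rewrite E in D; apply is_series_Cx_ext with (2 := D); intros k; ring.
Qed.

Definition derive_series (a : nat -> Cx) (z : Cx) : Cx :=
  Cx_series (fun k => Cmul (Cpow z k) (derive_coef a k)).

Lemma disc_series_derive_series (a : nat -> Cx) (f : Cx -> Cx) :
  disc_series a f -> disc_series (derive_coef a) (derive_series a).
Proof.
  intros H z Hz; apply (is_series_Cx_series _ (fun k => Cnorm (derive_coef a k) * Cnorm z ^ k)).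
  - apply (derive_coef_summable a f); auto; pose proof (Cnorm_ge0 z); unfold inD in Hz; lra.
  - intros k; rewrite Cnorm_mul, Cnorm_pow; right; ring.
Qed.

Lemma is_derive_disc_series (a : nat -> Cx) (f : Cx -> Cx) (z : Cx) :
  disc_series a f -> inD z -> is_derive f z (derive_series a z).
Proof.
  intros H Hz; assert (Nz := Hz); unfold inD in Nz; pose proof (Cnorm_ge0 z).
  set (rho := (1 + Cnorm z) / 2); assert (Hrho : 0 <= rho < 1) by (unfold rho; lra).
  pose proof (derive_coef_summable a f rho H Hrho) as Hsum.
  set (u := fun k w => Cmul (a (S k)) (pow_slope z (S k) w)).
  set (phi := fun w => Cx_series (fun k => u k w)).
  assert (Near : locally z (fun w => Cnorm w < rho)) by (apply locally_Cnorm_lt; unfold rho; lra).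
  assert (Bound : forall w, Cnorm w < rho ->
    forall k, Cnorm (u k w) <= Cnorm (derive_coef a k) * rho ^ k).
  { intros w Hw k; unfold u; rewrite Cnorm_mul, Cnorm_derive_coef.
    pose proof (Cnorm_pow_slope_le z w rho k ltac:(unfold rho; lra) ltac:(lra)).
    pose proof (Cnorm_ge0 (a (S k))); nra. }
  assert (Hphi : forall w, Cnorm w < rho -> is_series (fun k => u k w) (phi w)).
  { intros w Hw; exact (is_series_Cx_series _ _ Hsum (Bound w Hw)). }
  replace (derive_series a z) with (phi z).
  - apply is_derive_Cx_of_slope.
    + apply (filter_imp _ _) with (2 := Near); intros w Hw.
      apply (is_series_Cx_unique _ _ _
        (disc_series_diff a f z w H Hz ltac:(unfold inD; lra))).
      exact (is_series_scal (Csub w z) _ _ (Hphi w Hw)).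
    + apply (weierstrass_M_test u phi _ z Hsum).
      * exact (filter_imp _ _ Bound Near).
      * exact (filter_imp _ _ Hphi Near).
      * intros k; apply continuous_Cmul; [apply continuous_const|apply continuous_pow_slope].
  - apply (is_series_Cx_unique (fun k => Cmul (Cpow z k) (derive_coef a k)));
      [|exact (disc_series_derive_series a f H z Hz)].
    apply is_series_Cx_ext with (2 := Hphi z (locally_singleton _ _ Near)); intros k.
    unfold u; rewrite pow_slope_diag; unfold derive_coef; ring.
Qed.

Lemma disc_series_derive (a : nat -> Cx) (f f1 : Cx -> Cx) :
  disc_series a f -> (forall z, inD z -> is_derive f z (f1 z)) -> disc_series (derive_coef a) f1.
Proof.
  intros H D; apply disc_series_ext with (2 := disc_series_derive_series a f H); intros z Hz.
  exact (is_derive_Cx_unique f z _ _ (is_derive_disc_series a f z H Hz) (D z Hz)).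
Qed.

Lemma disc_series_zero_coef (a : nat -> Cx) (k : nat) : disc_series a (fun _ => C0) -> a k = C0.
Proof.
  revert a; induction k as [|k IH]; intros a H.
  - now rewrite <- (disc_series_at_0 a _ H).
  - assert (E : derive_coef a k = C0).
    { apply IH, (disc_series_derive a (fun _ => C0)); auto; intros z _.
      exact (is_derive_const C0 z). }
    assert (Sk_neq0 : RtoC (INR (S k)) <> C0) by (apply RtoC_neq0, not_0_INR; lia).
    transitivity (Cmul (Cinv (RtoC (INR (S k)))) (derive_coef a k)).
    + unfold derive_coef; field; exact Sk_neq0.
    + rewrite E; ring.
Qed.

Lemma disc_series_unique (a b : nat -> Cx) (f : Cx -> Cx) (k : nat) :
  disc_series a f -> disc_series b f -> a k = b k.
Proof.
  intros Ha Hb; apply Csub_eq0.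
  transitivity (PS_plus a (PS_scal (Copp C1) b) k).
  - change (Csub (a k) (b k) = Cadd (a k) (Cmul (Copp C1) (b k))); ring.
  - apply disc_series_zero_coef.
    apply disc_series_ext with (2 := disc_series_plus _ _ _ _ Ha (disc_series_scal _ _ _ Hb)).
    intros z _; ring.
Qed.

(** * The mean value property *)

Definition C1_holomorphic (G : Cx -> Cx) : Prop :=
  exists G1, forall z, inD z -> is_derive G z (G1 z) /\ continuous G1 z.

Lemma C1_holomorphic_continuous (G : Cx -> Cx) (z : Cx) :
  C1_holomorphic G -> inD z -> continuous G z.
Proof. intros [G1 HG] Hz; exact (is_derive_Cx_continuous _ _ _ (proj1 (HG z Hz))). Qed.

Lemma C1_holomorphic_const (c : Cx) : C1_holomorphic (fun _ => c).
Proof.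
  exists (fun _ => C0); intros z _; split; [exact (is_derive_const c z)|apply continuous_const].
Qed.

Lemma C1_holomorphic_id : C1_holomorphic (fun z => z).
Proof.
  exists (fun _ => C1); intros z _; split; [exact (is_derive_id z)|apply continuous_const].
Qed.

Lemma C1_holomorphic_add (f g : Cx -> Cx) :
  C1_holomorphic f -> C1_holomorphic g -> C1_holomorphic (fun z => Cadd (f z) (g z)).
Proof.
  intros [f1 Hf] [g1 Hg]; exists (fun z => Cadd (f1 z) (g1 z)); intros z Hz.
  destruct (Hf z Hz), (Hg z Hz); split; [now apply is_derive_Cadd|now apply continuous_Cadd].
Qed.

Lemma C1_holomorphic_opp (f : Cx -> Cx) :
  C1_holomorphic f -> C1_holomorphic (fun z => Copp (f z)).
Proof.
  intros [f1 Hf]; exists (fun z => Copp (f1 z)); intros z Hz.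
  destruct (Hf z Hz); split; [now apply is_derive_Copp|now apply continuous_Copp].
Qed.

Lemma C1_holomorphic_mul (f g : Cx -> Cx) :
  C1_holomorphic f -> C1_holomorphic g -> C1_holomorphic (fun z => Cmul (f z) (g z)).
Proof.
  intros Hf Hg; pose proof Hf as [f1 Hf1]; pose proof Hg as [g1 Hg1].
  exists (fun z => Cadd (Cmul (f1 z) (g z)) (Cmul (f z) (g1 z))); intros z Hz.
  destruct (Hf1 z Hz), (Hg1 z Hz); split; [now apply is_derive_Cmul|].
  apply continuous_Cadd; apply continuous_Cmul; auto using C1_holomorphic_continuous.
Qed.

Lemma C1_holomorphic_inv (f : Cx -> Cx) :
  (forall z, inD z -> f z <> C0) -> C1_holomorphic f -> C1_holomorphic (fun z => Cinv (f z)).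
Proof.
  intros f_neq0 Hf; pose proof Hf as [f1 Hf1].
  exists (fun z => Copp (Cdiv (f1 z) (Cmul (f z) (f z)))); intros z Hz.
  destruct (Hf1 z Hz); split; [now apply is_derive_Cinv; auto|].
  pose proof (C1_holomorphic_continuous f z Hf Hz).
  apply continuous_Copp, continuous_Cmul; auto.
  apply continuous_Cinv; [apply Cmul_neq0; auto|now apply continuous_Cmul].
Qed.

Lemma C1_holomorphic_disc_series (a : nat -> Cx) (f : Cx -> Cx) :
  disc_series a f -> C1_holomorphic f.
Proof.
  intros H; exists (derive_series a); intros z Hz; split.
  - exact (is_derive_disc_series a f z H Hz).
  - eapply is_derive_Cx_continuous, is_derive_disc_series; [|exact Hz].
    exact (disc_series_derive_series a f H).
Qed.

Definition polar (r t : R) : Cx := mkC (r * cos t) (r * sin t).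

Lemma polarE (r t : R) : polar r t = Cmul (RtoC r) (Cexpi t).
Proof. apply Cx_eq; simpl; ring. Qed.

Lemma Cnorm_polar (r t : R) : Cnorm (polar r t) = Rabs r.
Proof. rewrite polarE, Cnorm_mul, Cnorm_Cexpi, Cnorm_RtoC; ring. Qed.

Lemma inD_polar (r t : R) : Rabs r < 1 -> inD (polar r t).
Proof. unfold inD; now rewrite Cnorm_polar. Qed.

Lemma continuous_polar (p : R * R) : continuous (fun q => polar (fst q) (snd q)) p.
Proof.
  destruct p as [r t].
  assert (Hfst : continuous (fun q : R * R => fst q) (r, t)) by apply continuous_fst.
  apply continuous_mkC; apply (continuous_mult (K := R_AbsRing)); auto.
  - apply (continuous_comp snd cos); [apply continuous_snd|apply continuous_cos].
  - apply (continuous_comp snd sin); [apply continuous_snd|apply continuous_sin].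
Qed.

Lemma continuous_pair_r (r t : R) : continuous (fun u : R => (r, u)) t.
Proof.
  intros P [e He]; exists e; intros u Hu; apply He; split; [apply ball_center|exact Hu].
Qed.

Lemma continuous_polar_comp {U : UniformSpace} (G : Cx -> U) (r t : R) :
  continuous G (polar r t) -> continuous (fun u => G (polar r u)) t.
Proof.
  intros HG; apply (continuous_comp (polar r) G); [|exact HG].
  exact (continuous_comp _ _ t (continuous_pair_r r t) (continuous_polar (r, t))).
Qed.

Lemma locally_Rabs_lt (r s : R) : Rabs r < s -> locally r (fun u => Rabs u < s).
Proof.
  intros Hr; assert (Hpos : 0 < s - Rabs r) by lra; exists (mkposreal _ Hpos); intros u Hu.
  change (Rabs (u - r) < s - Rabs r) in Hu.
  replace u with ((u - r) + r) by ring; pose proof (Rabs_triang (u - r) r); lra.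
Qed.

Section MeanValue.

Variables G G1 : Cx -> Cx.
Hypothesis HG : forall z, inD z -> is_derive G z (G1 z) /\ continuous G1 z.

Let radial_derive (r t : R) : R := re (Cmul (Cexpi t) (G1 (polar r t))).

Lemma is_derive_re_radius (r t : R) :
  Rabs r < 1 -> is_derive (fun u => re (G (polar u t))) r (radial_derive r t).
Proof.
  intros Hr; apply (is_derive_re_curve G (fun u => u * cos t) (fun u => u * sin t)).
  - now apply HG, inD_polar.
  - auto_derive; auto; ring.
  - auto_derive; auto; ring.
Qed.

Lemma is_derive_im_angle (r t : R) :
  Rabs r < 1 -> is_derive (fun u => im (G (polar r u))) t (r * radial_derive r t).
Proof.
  intros Hr; set (neg_i := mkC 0 (-1)).
  apply (is_derive_ext (fun u => re (Cmul neg_i (G (polar r u))))); [intros u; simpl; ring|].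
  replace (r * radial_derive r t)
    with (re (Cmul (mkC (r * - sin t) (r * cos t)) (Cmul neg_i (G1 (polar r t)))))
    by (unfold radial_derive; simpl; ring).
  apply (is_derive_re_curve (fun z => Cmul neg_i (G z)) (fun u => r * cos u) (fun u => r * sin u)).
  - now apply is_derive_Cmul_const, HG, inD_polar.
  - auto_derive; auto; ring.
  - auto_derive; auto; ring.
Qed.

Lemma continuous_radial_derive (r t : R) :
  Rabs r < 1 -> continuous (fun p : R * R => radial_derive (fst p) (snd p)) (r, t).
Proof.
  intros Hr; apply continuous_re_comp, continuous_Cmul.
  - apply continuous_mkC.
    + apply (continuous_comp snd cos); [apply continuous_snd|apply continuous_cos].
    + apply (continuous_comp snd sin); [apply continuous_snd|apply continuous_sin].
  - apply (continuous_comp (fun p : R * R => polar (fst p) (snd p)) G1).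
    + apply continuous_polar.
    + now apply HG, inD_polar.
Qed.

Lemma is_derive_circle_integral (r : R) : Rabs r < 1 ->
  is_derive (fun u => RInt (fun t => re (G (polar u t))) 0 (2 * PI)) r
    (RInt (radial_derive r) 0 (2 * PI)).
Proof.
  intros Hr; pose proof (locally_Rabs_lt r 1 Hr) as Near.
  rewrite (RInt_ext _ (fun t => Derive (fun u => re (G (polar u t))) r))
    by (intros t _; symmetry; now apply is_derive_unique, is_derive_re_radius).
  apply (is_derive_RInt_param (fun u t => re (G (polar u t)))).
  - apply (filter_imp _ _) with (2 := Near); intros u Hu t _.
    eexists; now apply is_derive_re_radius.
  - intros t _; apply continuity_2d_pt_ext_loc with (f := radial_derive).
    + destruct Near as [d Hd]; exists d; intros u v Hu _.
      symmetry; apply is_derive_unique, is_derive_re_radius, Hd, Hu.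
    + apply continuity_2d_pt_filterlim; now apply continuous_radial_derive.
  - apply (filter_imp _ _) with (2 := Near); intros u Hu.
    apply (ex_RInt_continuous (V := R_CompleteNormedModule)); intros t _.
    apply continuous_re_comp, continuous_polar_comp.
    eapply is_derive_Cx_continuous, HG, inD_polar, Hu.
Qed.

(* The integrand is [/ r] times the derivative of [im G] along the circle. *)
Lemma circle_integral_radial_derive (r : R) :
  0 < r < 1 -> RInt (radial_derive r) 0 (2 * PI) = 0.
Proof.
  intros Hr; assert (Habs : Rabs r < 1) by (rewrite Rabs_pos_eq; lra).
  assert (E : is_RInt (fun t => r * radial_derive r t) 0 (2 * PI)
                (im (G (polar r (2 * PI))) - im (G (polar r 0)))).
  { apply (is_RInt_derive (V := R_CompleteNormedModule) (fun t => im (G (polar r t)))).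
    - intros t _; now apply is_derive_im_angle.
    - intros t _; apply (continuous_scal_r (V := R_NormedModule) r).
      exact (continuous_comp _ _ t (continuous_pair_r r t) (continuous_radial_derive r t Habs)). }
  replace (polar r (2 * PI)) with (polar r 0) in E
    by (unfold polar; now rewrite cos_2PI, sin_2PI, cos_0, sin_0).
  rewrite Rminus_diag in E; apply is_RInt_unique.
  assert (cancel : forall t, / r * (r * radial_derive r t) = radial_derive r t)
    by (intros t; field; lra).
  apply (is_RInt_ext _ _ _ _ _ (fun t _ => cancel t)).
  replace 0 with (/ r * 0) at 2 by ring.
  exact (is_RInt_scal (V := R_NormedModule) _ _ _ (/ r) _ E).
Qed.

Lemma circle_integral_re (r : R) :
  0 < r < 1 -> RInt (fun t => re (G (polar r t))) 0 (2 * PI) = 2 * PI * re (G C0).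
Proof.
  intros Hr.
  destruct (MVT_gen (fun u => RInt (fun t => re (G (polar u t))) 0 (2 * PI)) 0 r (fun _ => 0))
    as [s [_ Hs]]; rewrite ?Rmin_left, ?Rmax_right in * by lra.
  - intros s Hs; pose proof (is_derive_circle_integral s) as D.
    rewrite circle_integral_radial_derive in D by lra.
    apply D; rewrite Rabs_pos_eq; lra.
  - intros s Hs; apply continuity_pt_filterlim.
    apply (ex_derive_continuous (V := R_NormedModule)
             (fun u => RInt (fun t => re (G (polar u t))) 0 (2 * PI))).
    eexists; apply is_derive_circle_integral; rewrite Rabs_pos_eq; lra.
  - assert (at_center : RInt (fun t => re (G (polar 0 t))) 0 (2 * PI) =
                        (2 * PI - 0) * re (G C0)).
    { rewrite (RInt_ext (fun t => re (G (polar 0 t))) (fun _ => re (G C0))).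
      - exact (RInt_const (V := R_CompleteNormedModule) 0 (2 * PI) (re (G C0))).
      - intros t _; do 2 f_equal; apply Cx_eq; simpl; ring. }
    lra.
Qed.

End MeanValue.

Definition is_circle_mean (r : R) (phi : Cx -> R) (m : R) : Prop :=
  is_RInt (fun t => phi (polar r t)) 0 (2 * PI) (2 * PI * m).

Lemma is_circle_mean_ext (r : R) (phi psi : Cx -> R) (m : R) :
  (forall z, Cnorm z = Rabs r -> phi z = psi z) -> is_circle_mean r phi m -> is_circle_mean r psi m.
Proof.
  intros E; apply is_RInt_ext; intros t _; apply E, Cnorm_polar.
Qed.

Lemma is_circle_mean_const (r c : R) : is_circle_mean r (fun _ => c) c.
Proof.
  unfold is_circle_mean; replace (2 * PI * c) with ((2 * PI - 0) * c) by ring.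
  exact (is_RInt_const (V := R_NormedModule) 0 (2 * PI) c).
Qed.

Lemma is_circle_mean_plus (r : R) (phi psi : Cx -> R) (m n : R) :
  is_circle_mean r phi m -> is_circle_mean r psi n ->
  is_circle_mean r (fun z => phi z + psi z) (m + n).
Proof.
  unfold is_circle_mean; rewrite Rmult_plus_distr_l.
  exact (is_RInt_plus (V := R_NormedModule) _ _ _ _ _ _).
Qed.

Lemma is_circle_mean_scal (r c : R) (phi : Cx -> R) (m : R) :
  is_circle_mean r phi m -> is_circle_mean r (fun z => c * phi z) (c * m).
Proof.
  unfold is_circle_mean; replace (2 * PI * (c * m)) with (c * (2 * PI * m)) by ring.
  exact (is_RInt_scal (V := R_NormedModule) _ _ _ c _).
Qed.

Lemma is_circle_mean_le (r : R) (phi psi : Cx -> R) (m n : R) :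
  is_circle_mean r phi m -> is_circle_mean r psi n ->
  (forall z, Cnorm z = Rabs r -> phi z <= psi z) -> m <= n.
Proof.
  intros Hphi Hpsi Hle; pose proof PI_RGT_0 as Hpi.
  apply Rmult_le_reg_l with (2 * PI); [lra|].
  apply (is_RInt_le _ _ 0 (2 * PI) _ _) with (2 := Hphi) (3 := Hpsi); [lra|].
  intros t _; apply Hle, Cnorm_polar.
Qed.

Lemma is_circle_mean_re (G : Cx -> Cx) (r : R) :
  C1_holomorphic G -> 0 < r < 1 -> is_circle_mean r (fun z => re (G z)) (re (G C0)).
Proof.
  intros HG Hr; pose proof HG as [G1 HG1]; unfold is_circle_mean.
  rewrite <- (circle_integral_re G G1 HG1 r Hr).
  apply (RInt_correct (V := R_CompleteNormedModule)), ex_RInt_continuous; intros t _.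
  apply continuous_re_comp, continuous_polar_comp, C1_holomorphic_continuous; auto.
  apply inD_polar; rewrite Rabs_pos_eq; lra.
Qed.

Lemma ex_circle_mean_Cnorm_sqr (G : Cx -> Cx) (r : R) :
  C1_holomorphic G -> 0 < r < 1 -> exists m, is_circle_mean r (fun z => Cnorm (G z) ^ 2) m.
Proof.
  intros HG Hr; pose proof PI_RGT_0 as Hpi.
  set (I := RInt (fun t => Cnorm (G (polar r t)) ^ 2) 0 (2 * PI) : R).
  exists (I / (2 * PI)); unfold is_circle_mean.
  replace (2 * PI * (I / (2 * PI))) with I by (field; lra).
  apply (RInt_correct (V := R_CompleteNormedModule)), ex_RInt_continuous; intros t _.
  apply (continuous_comp (fun t => Cnorm (G (polar r t))) (fun x => x ^ 2)).
  - apply continuous_Cnorm_comp, continuous_polar_comp, C1_holomorphic_continuous; auto.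
    apply inD_polar; rewrite Rabs_pos_eq; lra.
  - apply (ex_derive_continuous (V := R_NormedModule)); auto_derive; auto.
Qed.

(** * Mean squares of power series *)

Lemma Cnorm_add_sqr (z w : Cx) :
  Cnorm (Cadd z w) ^ 2 = Cnorm z ^ 2 + 2 * re (Cmul (mkC (re z) (- im z)) w) + Cnorm w ^ 2.
Proof. rewrite !Cnorm_sqr; simpl; ring. Qed.

Lemma is_circle_mean_Cnorm_sqr_add_mul (c : Cx) (G : Cx -> Cx) (r m : R) :
  C1_holomorphic G -> 0 < r < 1 -> is_circle_mean r (fun z => Cnorm (G z) ^ 2) m ->
  is_circle_mean r (fun z => Cnorm (Cadd c (Cmul z (G z))) ^ 2) (Cnorm c ^ 2 + r ^ 2 * m).
Proof.
  intros HG Hr Hm; set (cross := fun z => Cmul (mkC (re c) (- im c)) (Cmul z (G z))).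
  assert (Hcross : is_circle_mean r (fun z => re (cross z)) 0).
  { replace 0 with (re (cross C0)) by (unfold cross; simpl; ring).
    apply is_circle_mean_re; auto; unfold cross.
    auto using C1_holomorphic_mul, C1_holomorphic_const, C1_holomorphic_id. }
  replace (Cnorm c ^ 2 + r ^ 2 * m) with (Cnorm c ^ 2 + 2 * 0 + r ^ 2 * m) by ring.
  eapply is_circle_mean_ext;
    [|apply is_circle_mean_plus;
      [apply is_circle_mean_plus;
        [apply (is_circle_mean_const r (Cnorm c ^ 2))|apply (is_circle_mean_scal _ 2 _ _ Hcross)]
      |apply (is_circle_mean_scal _ (r ^ 2) _ _ Hm)]].
  intros z Hz; rewrite Cnorm_add_sqr, (Cnorm_mul z), Hz, Rpow_mult_distr, pow2_abs.
  reflexivity.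
Qed.

(* [horner p n z t] is [p 0 + p 1 z + ... + p (n - 1) z ^ (n - 1) + z ^ n t]. *)
Fixpoint horner (p : nat -> Cx) (n : nat) (z t : Cx) : Cx :=
  match n with
  | O => t
  | S m => Cadd (p 0%nat) (Cmul z (horner (fun k => p (S k)) m z t))
  end.

Lemma horner_add (p : nat -> Cx) (n : nat) (z s t : Cx) :
  horner p n z (Cadd s t) = Cadd (horner p n z s) (Cmul (Cpow z n) t).
Proof. revert p; induction n as [|n IH]; intros p; simpl; [|rewrite IH]; ring. Qed.

Lemma C1_holomorphic_horner (p : nat -> Cx) (n : nat) (T : Cx -> Cx) :
  C1_holomorphic T -> C1_holomorphic (fun z => horner p n z (T z)).
Proof.
  intros HT; revert p; induction n as [|n IH]; intros p; [exact HT|].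
  apply C1_holomorphic_add, C1_holomorphic_mul;
    auto using C1_holomorphic_const, C1_holomorphic_id.
Qed.

Lemma disc_series_horner (p : nat -> Cx) (f : Cx -> Cx) (n : nat) :
  disc_series p f ->
  exists T, C1_holomorphic T /\ forall z, inD z -> f z = horner p n z (T z).
Proof.
  revert p f; induction n as [|n IH]; intros p f H.
  - exists f; split; auto; exact (C1_holomorphic_disc_series p f H).
  - destruct (disc_series_decr_1 p f H) as [g [Hg E]].
    destruct (IH _ g Hg) as [T [HT ET]]; exists T; split; auto.
    intros z Hz; rewrite E, ET by exact Hz; reflexivity.
Qed.

Definition square_sum (p : nat -> Cx) (r : R) (n : nat) : R :=
  sum_f_R0 (fun k => Cnorm (p k) ^ 2 * (r ^ 2) ^ k) n.

Lemma square_sum_S (p : nat -> Cx) (r : R) (n : nat) :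
  square_sum p r (S n) = Cnorm (p 0%nat) ^ 2 + r ^ 2 * square_sum (fun k => p (S k)) r n.
Proof.
  unfold square_sum; rewrite decomp_sum, scal_sum by lia; f_equal; [ring|].
  apply sum_eq; intros k _; simpl; ring.
Qed.

Lemma parseval_horner (p : nat -> Cx) (n : nat) (T : Cx -> Cx) (r m : R) :
  C1_holomorphic T -> 0 < r < 1 -> is_circle_mean r (fun z => Cnorm (T z) ^ 2) m ->
  is_circle_mean r (fun z => Cnorm (horner p (S n) z (T z)) ^ 2)
    (square_sum p r n + (r ^ 2) ^ S n * m).
Proof.
  intros HT Hr Hm; revert p; induction n as [|n IH]; intros p.
  - replace (square_sum p r 0 + (r ^ 2) ^ 1 * m) with (Cnorm (p 0%nat) ^ 2 + r ^ 2 * m)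
      by (unfold square_sum; simpl; ring).
    now apply is_circle_mean_Cnorm_sqr_add_mul.
  - rewrite square_sum_S.
    replace (_ + _ + _) with (Cnorm (p 0%nat) ^ 2 +
        r ^ 2 * (square_sum (fun k => p (S k)) r n + (r ^ 2) ^ S n * m)) by (simpl; ring).
    apply (is_circle_mean_Cnorm_sqr_add_mul (p 0%nat)
             (fun z => horner (fun k => p (S k)) (S n) z (T z))); auto.
    now apply C1_holomorphic_horner.
Qed.

Lemma parseval_polynomial (q : nat -> Cx) (n : nat) (r : R) :
  0 < r < 1 -> is_circle_mean r (fun z => Cnorm (horner q (S n) z C0) ^ 2) (square_sum q r n).
Proof.
  intros Hr; replace (square_sum q r n) with (square_sum q r n + (r ^ 2) ^ S n * 0) by ring.
  apply (parseval_horner q n (fun _ => C0)); [apply C1_holomorphic_const|exact Hr|].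
  rewrite Cnorm_C0; replace (0 ^ 2) with 0 by ring; apply is_circle_mean_const.
Qed.

Lemma bessel_horner (p : nat -> Cx) (n : nat) (T : Cx -> Cx) (r : R) :
  C1_holomorphic T -> 0 < r < 1 ->
  exists m, square_sum p r n <= m /\
    is_circle_mean r (fun z => Cnorm (horner p (S n) z (T z)) ^ 2) m.
Proof.
  intros HT Hr; destruct (ex_circle_mean_Cnorm_sqr T r HT Hr) as [m Hm].
  assert (m_ge0 : 0 <= m).
  { apply (is_circle_mean_le r (fun _ => 0) _ 0 m) with (2 := Hm);
      [apply is_circle_mean_const|intros; apply pow2_ge_0]. }
  exists (square_sum p r n + (r ^ 2) ^ S n * m); split; [|now apply parseval_horner].
  pose proof (pow_le (r ^ 2) (S n) (pow2_ge_0 r)); nra.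
Qed.

(* Clunie's method: with [omega = f / F], the product of [omega] and the Taylor polynomial of [F]
   agrees with the Taylor polynomial of [f] up to a multiple of [z ^ (n + 1)], which can only
   increase the mean square. *)
Lemma clunie_inequality_circle (p q : nat -> Cx) (f F : Cx -> Cx) (r M : R) (n : nat) :
  disc_series p f -> disc_series q F -> (forall z, inD z -> F z <> C0) -> 0 < r < 1 ->
  (forall z, Cnorm z = r -> Cnorm (f z) <= M * Cnorm (F z)) ->
  square_sum p r n <= M ^ 2 * square_sum q r n.
Proof.
  intros Hp Hq HF Hr Hle.
  destruct (disc_series_horner p f (S n) Hp) as [Tf [HTf Ef]].
  destruct (disc_series_horner q F (S n) Hq) as [TF [HTF EF]].
  set (omega := fun z => Cmul (f z) (Cinv (F z))).
  set (T := fun z => Cadd (Tf z) (Copp (Cmul (omega z) (TF z)))).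
  assert (HT : C1_holomorphic T).
  { apply C1_holomorphic_add, C1_holomorphic_opp, C1_holomorphic_mul, HTF; [exact HTf|].
    apply C1_holomorphic_mul, C1_holomorphic_inv; eauto using C1_holomorphic_disc_series. }
  assert (ET : forall z, inD z -> horner p (S n) z (T z) = Cmul (omega z) (horner q (S n) z C0)).
  { intros z Hz; unfold T; rewrite horner_add, <- Ef by exact Hz.
    specialize (EF z Hz); replace (TF z) with (Cadd C0 (TF z)) in EF by ring.
    rewrite horner_add in EF.
    transitivity (Cmul (omega z) (Csub (F z) (Cmul (Cpow z (S n)) (TF z))));
      [unfold omega; field; auto|rewrite EF; ring]. }
  destruct (bessel_horner p n T r HT Hr) as [m [Hpm Hm]].
  eapply Rle_trans; [exact Hpm|].
  apply (is_circle_mean_le r) with (1 := Hm)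
    (2 := is_circle_mean_scal r (M ^ 2) _ _ (parseval_polynomial q n r Hr)).
  intros z Hz; rewrite Rabs_pos_eq in Hz by lra; assert (Dz : inD z) by (unfold inD; lra).
  rewrite ET, <- Rpow_mult_distr, Cnorm_mul by exact Dz.
  apply pow_incr; split; [apply Rmult_le_pos; apply Cnorm_ge0|].
  apply Rmult_le_compat_r; [apply Cnorm_ge0|].
  pose proof (Cnorm_gt0 _ (HF z Dz)); unfold omega; rewrite Cnorm_mul, Cnorm_inv by auto.
  apply Rmult_le_reg_r with (Cnorm (F z)); auto.
  rewrite Rmult_assoc, Rinv_l, Rmult_1_r by lra; auto.
Qed.

Lemma continuous_square_sum (p : nat -> Cx) (n : nat) (r : R) :
  continuous (fun s => square_sum p s n) r.
Proof.
  apply continuity_pt_filterlim.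
  apply (continuity_pt_finite_SF (fun k s => Cnorm (p k) ^ 2 * (s ^ 2) ^ k)); intros k _.
  apply derivable_continuous_pt; reg.
Qed.

Lemma square_sum_1 (p : nat -> Cx) (n : nat) :
  square_sum p 1 n = sum_f_R0 (fun k => Cnorm (p k) ^ 2) n.
Proof. apply sum_eq; intros k _; rewrite !pow1; ring. Qed.

Lemma clunie_inequality (p q : nat -> Cx) (f F : Cx -> Cx) (n : nat) :
  disc_series p f -> disc_series q F -> (forall z, inD z -> F z <> C0) ->
  (forall z, inD z -> Cnorm (Cmul z (f z)) <= Cnorm (F z)) ->
  sum_f_R0 (fun k => Cnorm (p k) ^ 2) n <= sum_f_R0 (fun k => Cnorm (q k) ^ 2) n.
Proof.
  intros Hp Hq HF Hle; rewrite <- !square_sum_1.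
  assert (Hr : forall r, 0 < r < 1 -> r ^ 2 * square_sum p r n <= square_sum q r n).
  { intros r Hr; apply Rmult_le_reg_l with ((/ r) ^ 2); [apply pow_lt, Rinv_0_lt_compat; lra|].
    replace ((/ r) ^ 2 * (r ^ 2 * square_sum p r n)) with (square_sum p r n) by (field; lra).
    apply (clunie_inequality_circle p q f F); auto; intros z Hz.
    specialize (Hle z ltac:(unfold inD; lra)); rewrite Cnorm_mul, Hz in Hle.
    apply Rmult_le_reg_l with r; [lra|].
    replace (r * (/ r * Cnorm (F z))) with (Cnorm (F z)) by (field; lra); exact Hle. }
  assert (Cp : continuous (fun r => r ^ 2 * square_sum p r n) 1).
  { apply (continuous_mult (K := R_AbsRing)); [|apply continuous_square_sum].
    apply continuity_pt_filterlim, derivable_continuous_pt; reg. }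
  apply (filterlim_le (F := at_left 1) (fun r => r ^ 2 * square_sum p r n)
           (fun r => square_sum q r n) (square_sum p 1 n) (square_sum q 1 n)).
  - exists (mkposreal 1 Rlt_0_1); intros r Br Hr1; apply Hr.
    change (Rabs (r - 1) < 1) in Br; apply Rabs_def2 in Br; lra.
  - replace (square_sum p 1 n) with (1 ^ 2 * square_sum p 1 n) by ring.
    exact (filterlim_filter_le_1 _ (filter_le_within _) Cp).
  - exact (filterlim_filter_le_1 _ (filter_le_within _) (continuous_square_sum q n 1)).
Qed.

(** * Coefficient bounds *)

Lemma A_1 (alpha : R) : A 1 alpha = 1.
Proof. unfold A; simpl; field. Qed.

Lemma A_succ (alpha : R) (n : nat) :
  INR (S (S n)) * A (S (S n)) alpha = (INR (S (S n)) - 2 * alpha) * A (S n) alpha.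
Proof.
  unfold A; change (prodA (S (S n)) alpha) with (prodA (S n) alpha * (INR (S (S n)) - 2 * alpha)).
  rewrite (fact_simpl (S n)), mult_INR; field; split; [apply INR_fact_neq_0|apply not_0_INR; lia].
Qed.

Lemma INR_A_succ (alpha : R) (n : nat) :
  INR (S n) * (INR (S (S n)) * A (S (S n)) alpha) =
  (INR n + 2 * (1 - alpha)) * (INR (S n) * A (S n) alpha).
Proof. rewrite A_succ, !S_INR; ring. Qed.

Lemma A_ge0 (alpha : R) (n : nat) : alpha < 1 -> 0 <= A (S n) alpha.
Proof.
  intros Ha; induction n as [|n IH]; [rewrite A_1; lra|].
  apply Rmult_le_reg_l with (INR (S (S n))); [apply lt_0_INR; lia|].
  rewrite A_succ, Rmult_0_r; apply Rmult_le_pos; [|exact IH].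
  rewrite !S_INR; pose proof (pos_INR n); lra.
Qed.

Lemma conj_bound_A (alpha : R) (n : nat) : alpha < 1 ->
  (INR (S (S n)) - 1) / (INR (S (S n)) - 2 * alpha) * A (S (S n)) alpha =
  INR (S n) / INR (S (S n)) * A (S n) alpha.
Proof.
  intros Ha; pose proof (A_succ alpha n) as E; pose proof (pos_INR n).
  assert (0 < INR (S (S n)) - 2 * alpha) by (rewrite !S_INR; lra).
  assert (0 < INR (S (S n))) by (apply lt_0_INR; lia).
  replace (INR (S (S n)) - 1) with (INR (S n)) by (rewrite !S_INR; ring).
  apply Rmult_eq_reg_l with (INR (S (S n))); [|lra].
  transitivity (INR (S n) / (INR (S (S n)) - 2 * alpha) * (INR (S (S n)) * A (S (S n)) alpha));
    [ring|rewrite E; field; lra].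
Qed.

Lemma sum_sqr_telescope (x : nat -> R) (kappa : R) (n : nat) :
  sum_f_R0 (fun k => ((INR k + kappa) * x k) ^ 2) n -
  sum_f_R0 (fun k => (INR (S k) * x (S k)) ^ 2) n =
  sum_f_R0 (fun k => ((INR k + kappa) ^ 2 - INR k ^ 2) * x k ^ 2) n -
  (INR (S n) * x (S n)) ^ 2.
Proof.
  induction n as [|n IH]; [simpl; ring|].
  rewrite !tech5; transitivity
    ((sum_f_R0 (fun k => ((INR k + kappa) * x k) ^ 2) n -
      sum_f_R0 (fun k => (INR (S k) * x (S k)) ^ 2) n) +
     ((INR (S n) + kappa) * x (S n)) ^ 2 - (INR (S (S n)) * x (S (S n))) ^ 2); [ring|].
  rewrite IH; ring.
Qed.

Lemma le_of_sum_sqr_recursion (x y : nat -> R) (kappa : R) :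
  0 <= kappa -> (forall k, 0 <= x k) -> (forall k, 0 <= y k) -> x 0%nat <= y 0%nat ->
  (forall n, sum_f_R0 (fun k => (INR (S k) * x (S k)) ^ 2) n <=
             sum_f_R0 (fun k => ((INR k + kappa) * x k) ^ 2) n) ->
  (forall n, INR (S n) * y (S n) = (INR n + kappa) * y n) ->
  forall n, x n <= y n.
Proof.
  intros Hkappa Hx Hy Hinit Hsum Hrec n.
  induction n as [n IH] using (well_founded_induction Nat.lt_wf_0).
  destruct n as [|n]; [exact Hinit|].
  assert (INR_pos : 0 < INR (S n)) by (apply lt_0_INR; lia).
  apply Rmult_le_reg_l with (INR (S n)); [exact INR_pos|].
  assert (y_ge0 : 0 <= INR (S n) * y (S n)) by (apply Rmult_le_pos; auto; lra).
  apply Rsqr_incr_0_var; [rewrite !Rsqr_pow2|exact y_ge0].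
  pose proof (sum_sqr_telescope x kappa n) as Ex; pose proof (sum_sqr_telescope y kappa n) as Ey.
  rewrite (sum_eq (fun k => (INR (S k) * y (S k)) ^ 2) (fun k => ((INR k + kappa) * y k) ^ 2)) in Ey
    by (intros k _; now rewrite Hrec).
  assert (Hle : sum_f_R0 (fun k => ((INR k + kappa) ^ 2 - INR k ^ 2) * x k ^ 2) n <=
                sum_f_R0 (fun k => ((INR k + kappa) ^ 2 - INR k ^ 2) * y k ^ 2) n).
  { apply sum_Rle; intros k Hk; apply Rmult_le_compat_l.
    - pose proof (pos_INR k); nra.
    - apply pow_incr; split; [apply Hx|apply IH; lia]. }
  specialize (Hsum n); lra.
Qed.

Lemma PS_incr_1_derive_coef (c : nat -> Cx) (k : nat) :
  PS_incr_1 (derive_coef c) k = Cmul (RtoC (INR k)) (c k).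
Proof.
  destruct k as [|k]; [|reflexivity].
  change (C0 = Cmul (RtoC 0) (c 0%nat)); change (RtoC 0) with C0; ring.
Qed.

Lemma sum_sqr_derive_coef_le (c : nat -> Cx) (f f1 : Cx -> Cx) (kappa : R) (n : nat) :
  0 <= kappa -> disc_series c f -> (forall z, inD z -> is_derive f z (f1 z)) ->
  (forall z, inD z -> Cadd (Cmul z (f1 z)) (Cmul (RtoC kappa) (f z)) <> C0 /\
     Cnorm (Cmul z (f1 z)) <= Cnorm (Cadd (Cmul z (f1 z)) (Cmul (RtoC kappa) (f z)))) ->
  sum_f_R0 (fun k => (INR (S k) * Cnorm (c (S k))) ^ 2) n <=
  sum_f_R0 (fun k => ((INR k + kappa) * Cnorm (c k)) ^ 2) n.
Proof.
  intros Hkappa Sf Df Hmaj.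
  assert (Sf1 : disc_series (derive_coef c) f1) by exact (disc_series_derive c f f1 Sf Df).
  set (q := PS_plus (PS_incr_1 (derive_coef c)) (PS_scal (RtoC kappa) c)).
  assert (SF : disc_series q (fun z => Cadd (Cmul z (f1 z)) (Cmul (RtoC kappa) (f z))))
    by (apply disc_series_plus; [now apply disc_series_incr_1|now apply disc_series_scal]).
  assert (Nq : forall k, Cnorm (q k) = (INR k + kappa) * Cnorm (c k)).
  { intros k; replace (q k) with (Cmul (RtoC (INR k + kappa)) (c k)).
    - rewrite Cnorm_mul, Cnorm_RtoC, Rabs_pos_eq by (pose proof (pos_INR k); lra); reflexivity.
    - change (q k) with (Cadd (PS_incr_1 (derive_coef c) k) (Cmul (RtoC kappa) (c k))).
      rewrite PS_incr_1_derive_coef, RtoC_add; ring. }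
  rewrite <- (sum_eq (fun k => Cnorm (derive_coef c k) ^ 2))
    by (intros k _; now rewrite Cnorm_derive_coef).
  rewrite <- (sum_eq (fun k => Cnorm (q k) ^ 2) (fun k => ((INR k + kappa) * Cnorm (c k)) ^ 2))
    by (intros k _; now rewrite Nq).
  apply (clunie_inequality _ _ f1 _ n Sf1 SF); intros z Hz; apply Hmaj, Hz.
Qed.

Lemma halfplane_majorant (beta : R) (u v : Cx) :
  0 < beta -> v <> C0 -> - beta < re (Cdiv u v) ->
  Cadd u (Cmul (RtoC (2 * beta)) v) <> C0 /\
  Cnorm u <= Cnorm (Cadd u (Cmul (RtoC (2 * beta)) v)).
Proof.
  intros Hbeta v_neq0 Hre; set (y := Cdiv u v) in *.
  assert (Eu : u = Cmul v y) by (unfold y; field; exact v_neq0).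
  clearbody y.
  replace (Cadd u (Cmul (RtoC (2 * beta)) v)) with (Cmul v (Cadd y (RtoC (2 * beta))))
    by (rewrite Eu; ring).
  split.
  - apply Cmul_neq0; auto; intros E; apply (f_equal re) in E; simpl in E; lra.
  - rewrite Eu, !Cnorm_mul; apply Rmult_le_compat_l; [apply Cnorm_ge0|].
    apply sqrt_le_1_alt; simpl; nra.
Qed.

Lemma in_F_coef_le (alpha : R) (h g : Cx -> Cx) (a : nat -> Cx) (n : nat) :
  alpha < 1 -> in_F alpha h g -> disc_series a h -> Cnorm (a (S n)) <= A (S n) alpha.
Proof.
  intros Ha [h1 [h2 [g1 [theta [_ [_ [h1_0 H]]]]]]] Sh; set (c := derive_coef a).
  assert (Sc : disc_series c h1).
  { apply (disc_series_derive a h); auto; intros z Hz; apply Cderiv_at_is_derive, H, Hz. }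
  apply Rmult_le_reg_l with (INR (S n)); [apply lt_0_INR; lia|].
  rewrite <- Cnorm_derive_coef; fold c.
  apply (le_of_sum_sqr_recursion (fun k => Cnorm (c k)) (fun k => INR (S k) * A (S k) alpha)
           (2 * (1 - alpha))).
  - lra.
  - intros k; apply Cnorm_ge0.
  - intros k; apply Rmult_le_pos; [apply pos_INR|now apply A_ge0].
  - rewrite <- (disc_series_at_0 c h1 Sc), h1_0, Cnorm_C1, A_1; simpl; lra.
  - intros m; apply (sum_sqr_derive_coef_le c h1 h2); auto; [lra| |].
    + intros z Hz; apply Cderiv_at_is_derive, H, Hz.
    + intros z Hz; destruct (H z Hz) as [_ [_ [_ [h1z_neq0 [Hre _]]]]].
      apply halfplane_majorant; auto; simpl in Hre |- *; lra.
  - apply INR_A_succ.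
Qed.

Lemma in_F_conj_coef (alpha : R) (h g : Cx -> Cx) (a b : nat -> Cx) (n : nat) :
  in_F alpha h g -> disc_series a h -> disc_series b g ->
  Cnorm (b (S (S n))) = INR (S n) / INR (S (S n)) * Cnorm (a (S n)).
Proof.
  intros [h1 [h2 [g1 [theta [_ [_ [_ H]]]]]]] Sh Sg.
  assert (Sh1 : disc_series (derive_coef a) h1).
  { apply (disc_series_derive a h); auto; intros z Hz; apply Cderiv_at_is_derive, H, Hz. }
  assert (Sg1 : disc_series (derive_coef b) g1).
  { apply (disc_series_derive b g); auto; intros z Hz; apply Cderiv_at_is_derive, H, Hz. }
  assert (Sg1' : disc_series (PS_scal (Cexpi theta) (PS_incr_1 (derive_coef a))) g1).
  { apply disc_series_ext
      with (2 := disc_series_scal (Cexpi theta) _ _ (disc_series_incr_1 _ _ Sh1)).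
    intros z Hz; symmetry; apply H, Hz. }
  pose proof (disc_series_unique _ _ _ (S n) Sg1 Sg1') as E.
  change (derive_coef b (S n) = Cmul (Cexpi theta) (derive_coef a n)) in E.
  apply (f_equal Cnorm) in E; rewrite Cnorm_mul, Cnorm_Cexpi, !Cnorm_derive_coef in E.
  assert (INR (S (S n)) <> 0) by (apply not_0_INR; lia).
  apply Rmult_eq_reg_l with (INR (S (S n))); auto.
  rewrite E; field; auto.
Qed.

(** * Exponential, logarithm and powers *)

Lemma Cexp_add (z w : Cx) : Cexp (Cadd z w) = Cmul (Cexp z) (Cexp w).
Proof. apply Cx_eq; simpl; rewrite exp_plus, ?cos_plus, ?sin_plus; ring. Qed.

Lemma Cexp_0 : Cexp C0 = C1.
Proof. apply Cx_eq; simpl; rewrite exp_0, ?cos_0, ?sin_0; ring. Qed.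

Lemma Cexp_neq0 (z : Cx) : Cexp z <> C0.
Proof.
  intros E; assert (Hinv : Cmul (Cexp z) (Cexp (Copp z)) = C1).
  { rewrite <- Cexp_add, <- Cexp_0; f_equal; ring. }
  rewrite E in Hinv; apply (f_equal re) in Hinv; simpl in Hinv; lra.
Qed.

Lemma Cexpi_add (s t : R) : Cexpi (s + t) = Cmul (Cexpi s) (Cexpi t).
Proof. apply Cx_eq; simpl; rewrite ?cos_plus, ?sin_plus; ring. Qed.

Lemma Cexpi_0 : Cexpi 0 = C1.
Proof. apply Cx_eq; [apply cos_0|apply sin_0]. Qed.

Lemma Cexpi_opp_l (t : R) : Cmul (Cexpi (- t)) (Cexpi t) = C1.
Proof. rewrite <- Cexpi_add, Rplus_opp_l; apply Cexpi_0. Qed.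

Lemma is_derive_Cexp (z : Cx) : is_derive Cexp z (Cexp z).
Proof.
  assert (Cont : forall (g : R -> R) (p : R * R), (forall t, continuous g t) ->
    continuous (fun u : R * R => exp (fst u) * g (snd u)) p).
  { intros g [x y] Hg; apply (continuous_mult (K := R_AbsRing));
      [apply (continuous_comp fst exp)|apply (continuous_comp snd g)];
      auto using continuous_fst, continuous_snd, continuous_exp. }
  apply is_derive_cauchy_riemann.
  - eapply filterdiff_ext_lin.
    + apply (is_derive_filterdiff (fun u v => exp u * cos v) (re z) (im z)
               (fun u v => exp u * cos v) (- (exp (re z) * sin (im z)))).
      * apply filter_forall; intros p; auto_derive; auto; ring.
      * auto_derive; auto; ring.
      * exact (Cont cos _ continuous_cos).
    + intros p; change (fst p * (exp (re z) * cos (im z)) + snd p * - (exp (re z) * sin (im z)) =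
        exp (re z) * cos (im z) * fst p - exp (re z) * sin (im z) * snd p); ring.
  - eapply filterdiff_ext_lin.
    + apply (is_derive_filterdiff (fun u v => exp u * sin v) (re z) (im z)
               (fun u v => exp u * sin v) (exp (re z) * cos (im z))).
      * apply filter_forall; intros p; auto_derive; auto; ring.
      * auto_derive; auto; ring.
      * exact (Cont sin _ continuous_sin).
    + intros p; change (fst p * (exp (re z) * sin (im z)) + snd p * (exp (re z) * cos (im z)) =
        exp (re z) * sin (im z) * fst p + exp (re z) * cos (im z) * snd p); ring.
Qed.

Lemma neq0_of_re_pos (z : Cx) : 0 < re z -> z <> C0.
Proof. intros Hz E; rewrite E in Hz; simpl in Hz; lra. Qed.

Lemma locally_re_pos (z : Cx) : 0 < re z -> locally z (fun w => 0 < re w).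
Proof.
  intros Hz; exists (mkposreal _ Hz); intros w Hw; change (Cnorm (Csub w z) < re z) in Hw.
  pose proof (Rabs_re_le (Csub w z)) as B; apply Rabs_le_between in B; simpl in B; lra.
Qed.

Lemma Carg_re_pos (z : Cx) : 0 < re z -> Carg z = atan (im z / re z).
Proof. intros Hz; unfold Carg; destruct Rlt_dec; [reflexivity|contradiction]. Qed.

Lemma Cexp_Clog (z : Cx) : 0 < re z -> Cexp (Clog z) = z.
Proof.
  intros Hz; pose proof (Cnorm_gt0 z (neq0_of_re_pos z Hz)) as Nz.
  assert (Hsqrt : sqrt (1 + (im z / re z)²) = Cnorm z / re z).
  { apply sqrt_lem_1; [unfold Rsqr; nra|apply Rdiv_le_0_compat; lra|].
    replace (Cnorm z / re z * (Cnorm z / re z)) with (Cnorm z ^ 2 / re z ^ 2) by (field; lra).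
    rewrite Cnorm_sqr; unfold Rsqr; field; lra. }
  unfold Cexp, Clog; cbn [re im]; rewrite exp_ln, Carg_re_pos, cos_atan, sin_atan, Hsqrt by auto.
  apply Cx_eq; simpl; field; lra.
Qed.

Lemma continuous_Clog (z : Cx) : 0 < re z -> continuous Clog z.
Proof.
  intros Hz; apply continuous_mkC.
  - apply (continuous_comp Cnorm ln); [apply continuous_Cnorm|].
    apply continuous_ln, Cnorm_gt0, neq0_of_re_pos, Hz.
  - apply (continuous_ext_loc _ (fun w => atan (im w / re w))).
    + apply (filter_imp _ _) with (2 := locally_re_pos z Hz); intros w Hw.
      symmetry; now apply Carg_re_pos.
    + apply (continuous_comp (fun w => im w / re w) atan); [|apply continuous_atan].
      apply continuous_Rdiv; [lra|apply continuous_im|apply continuous_re].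
Qed.

Lemma is_derive_Clog (z : Cx) : 0 < re z -> is_derive Clog z (Cinv z).
Proof.
  intros Hz; apply (is_derive_inverse_function Cexp).
  - exact (filter_imp _ _ Cexp_Clog (locally_re_pos z Hz)).
  - now apply continuous_Clog.
  - rewrite <- (Cexp_Clog z Hz) at 2; apply is_derive_Cexp.
  - now apply neq0_of_re_pos.
Qed.

Lemma Clog_1 : Clog C1 = C0.
Proof.
  apply Cx_eq; unfold Clog; cbn [re im].
  - rewrite Cnorm_C1; apply ln_1.
  - rewrite Carg_re_pos by (simpl; lra); simpl; unfold Rdiv; rewrite Rmult_0_l; apply atan_0.
Qed.

Lemma is_derive_Cpowc (c z : Cx) :
  0 < re z -> is_derive (fun w => Cpowc w c) z (Cdiv (Cmul c (Cpowc z c)) z).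
Proof.
  intros Hz; eapply is_derive_Cx_eq.
  - apply (is_derive_Cx_comp Cexp (fun w => Cmul c (Clog w))); [apply is_derive_Cexp|].
    apply is_derive_Cmul_const, is_derive_Clog, Hz.
  - unfold Cpowc; field; now apply neq0_of_re_pos.
Qed.

Lemma Cpowc_neq0 (z c : Cx) : Cpowc z c <> C0.
Proof. apply Cexp_neq0. Qed.

Lemma Cpowc_1_l (c : Cx) : Cpowc C1 c = C1.
Proof. unfold Cpowc; rewrite Clog_1, <- Cexp_0; f_equal; ring. Qed.

Lemma Cpowc_0_r (z : Cx) : Cpowc z (RtoC 0) = C1.
Proof. unfold Cpowc; rewrite <- Cexp_0; f_equal; change (RtoC 0) with C0; ring. Qed.

Lemma Cpowc_pred (z : Cx) (x : R) :
  0 < re z -> Cpowc z (RtoC (x - 1)) = Cdiv (Cpowc z (RtoC x)) z.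
Proof.
  intros Hz; replace (Cpowc z (RtoC x)) with (Cmul (Cpowc z (RtoC (x - 1))) z).
  - field; now apply neq0_of_re_pos.
  - rewrite <- (Cexp_Clog z Hz) at 2; unfold Cpowc; rewrite <- Cexp_add; f_equal.
    replace x with ((x - 1) + 1) at 2 by ring.
    rewrite (RtoC_add (x - 1) 1); change (RtoC 1) with C1; ring.
Qed.

(** * The extremal functions *)

Lemma re_one_sub (z : Cx) : inD z -> 0 < re (Csub C1 z).
Proof.
  unfold inD; intros H; pose proof (Rabs_re_le z) as B; apply Rabs_le_between in B; simpl; lra.
Qed.

Lemma one_sub_neq0 (z : Cx) : inD z -> Csub C1 z <> C0.
Proof. intros H; now apply neq0_of_re_pos, re_one_sub. Qed.

Lemma one_sub_C0 : Csub C1 C0 = C1.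
Proof. ring. Qed.

Lemma is_derive_one_sub (z : Cx) : is_derive (fun w => Csub C1 w) z (Copp C1).
Proof.
  eapply is_derive_Cx_eq; [apply is_derive_Csub; [apply is_derive_const|apply is_derive_id]|].
  change (Csub C0 C1 = Copp C1); ring.
Qed.

Lemma is_derive_log_one_sub (z : Cx) :
  inD z -> is_derive (fun w => Clog (Csub C1 w)) z (Copp (Cinv (Csub C1 z))).
Proof.
  intros Hz; eapply is_derive_Cx_eq.
  - apply (is_derive_Cx_comp Clog (fun w => Csub C1 w));
      [apply is_derive_Clog, re_one_sub, Hz|apply is_derive_one_sub].
  - ring.
Qed.

Lemma is_derive_pow_one_sub (c z : Cx) : inD z ->
  is_derive (fun w => Cpowc (Csub C1 w) c) z
    (Copp (Cdiv (Cmul c (Cpowc (Csub C1 z) c)) (Csub C1 z))).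
Proof.
  intros Hz; eapply is_derive_Cx_eq.
  - apply (is_derive_Cx_comp (fun w => Cpowc w c) (fun w => Csub C1 w));
      [apply is_derive_Cpowc, re_one_sub, Hz|apply is_derive_one_sub].
  - ring.
Qed.

Lemma is_derive_div_one_sub (z : Cx) : inD z ->
  is_derive (fun w => Cdiv w (Csub C1 w)) z (Cinv (Cmul (Csub C1 z) (Csub C1 z))).
Proof.
  intros Hz; pose proof (one_sub_neq0 z Hz) as Nz; eapply is_derive_Cx_eq.
  - apply (is_derive_Cdiv (fun w => w) (fun w => Csub C1 w)); auto;
      [apply is_derive_id|apply is_derive_one_sub].
  - change one with C1; field; auto.
Qed.

Definition h1_alpha (alpha : R) (z : Cx) : Cx := Cpowc (Csub C1 z) (RtoC (2 * alpha - 2)).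

Definition h2_alpha (alpha : R) (z : Cx) : Cx :=
  Cdiv (Cmul (RtoC (2 - 2 * alpha)) (h1_alpha alpha z)) (Csub C1 z).

Lemma h1_alpha_neq0 (alpha : R) (z : Cx) : h1_alpha alpha z <> C0.
Proof. apply Cpowc_neq0. Qed.

Lemma h1_alpha_C0 (alpha : R) : h1_alpha alpha C0 = C1.
Proof. unfold h1_alpha; rewrite one_sub_C0; apply Cpowc_1_l. Qed.

Lemma h1_alphaE (alpha : R) (z : Cx) : inD z ->
  h1_alpha alpha z = Cdiv (Cpowc (Csub C1 z) (RtoC (2 * alpha - 1))) (Csub C1 z).
Proof.
  intros Hz; rewrite <- Cpowc_pred by now apply re_one_sub.
  unfold h1_alpha; do 2 f_equal; ring.
Qed.

Lemma h1_alpha_half (z : Cx) : inD z -> h1_alpha (1 / 2) z = Cinv (Csub C1 z).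
Proof.
  intros Hz; pose proof (one_sub_neq0 z Hz).
  rewrite h1_alphaE by exact Hz; replace (2 * (1 / 2) - 1) with 0 by field.
  rewrite Cpowc_0_r; field; auto.
Qed.

Lemma h1_alpha_0 (z : Cx) : inD z -> h1_alpha 0 z = Cinv (Cmul (Csub C1 z) (Csub C1 z)).
Proof.
  intros Hz; pose proof (one_sub_neq0 z Hz).
  rewrite h1_alphaE by exact Hz; replace (2 * 0 - 1) with (0 - 1) by ring.
  rewrite Cpowc_pred, Cpowc_0_r by now apply re_one_sub.
  field; auto.
Qed.

Lemma is_derive_h_alpha (alpha : R) (z : Cx) : inD z ->
  is_derive (h_alpha alpha) z (h1_alpha alpha z).
Proof.
  intros Hz; pose proof (one_sub_neq0 z Hz) as Nz.
  unfold h_alpha; destruct Req_EM_T as [->|alpha_neq0]; [|destruct Req_EM_T as [->|alpha_neq_half]].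
  - rewrite h1_alpha_0 by exact Hz; now apply is_derive_div_one_sub.
  - rewrite h1_alpha_half by exact Hz; eapply is_derive_Cx_eq.
    + apply (is_derive_Copp (fun w => Clog (Csub C1 w))); now apply is_derive_log_one_sub.
    + ring.
  - assert (c_neq0 : RtoC (2 * alpha - 1) <> C0) by (apply RtoC_neq0; lra).
    rewrite h1_alphaE by exact Hz; eapply is_derive_Cx_eq.
    + apply (is_derive_Cdiv (fun w => Csub C1 (Cpowc (Csub C1 w) (RtoC (2 * alpha - 1))))
        (fun _ => RtoC (2 * alpha - 1))); auto; [|apply is_derive_const].
      apply is_derive_Csub; [apply is_derive_const|now apply is_derive_pow_one_sub].
    + change zero with C0; field; auto.
Qed.

Lemma is_derive_h1_alpha (alpha : R) (z : Cx) : inD z ->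
  is_derive (h1_alpha alpha) z (h2_alpha alpha z).
Proof.
  intros Hz; eapply is_derive_Cx_eq; [now apply is_derive_pow_one_sub|].
  unfold h2_alpha; fold (h1_alpha alpha z).
  replace (2 - 2 * alpha) with (-1 * (2 * alpha - 2)) by ring.
  rewrite (RtoC_mul (-1)); replace (RtoC (-1)) with (Copp C1) by (apply Cx_eq; simpl; ring).
  field; now apply one_sub_neq0.
Qed.

Lemma is_derive_g_alpha (alpha : R) (z : Cx) : inD z ->
  is_derive (g_alpha alpha) z (Cmul z (h1_alpha alpha z)).
Proof.
  intros Hz; pose proof (one_sub_neq0 z Hz) as Nz.
  unfold g_alpha; destruct Req_EM_T as [->|alpha_neq0]; [|destruct Req_EM_T as [->|alpha_neq_half]].
  - rewrite h1_alpha_0 by exact Hz; eapply is_derive_Cx_eq.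
    + apply (is_derive_Cadd (fun w => Cdiv w (Csub C1 w)) (fun w => Clog (Csub C1 w)));
        [now apply is_derive_div_one_sub|now apply is_derive_log_one_sub].
    + field; auto.
  - rewrite h1_alpha_half by exact Hz; eapply is_derive_Cx_eq.
    + apply (is_derive_Copp (fun w => Cadd w (Clog (Csub C1 w)))).
      apply is_derive_Cadd; [apply is_derive_id|now apply is_derive_log_one_sub].
    + change one with C1; field; auto.
  - rewrite h1_alphaE by exact Hz; set (c := 2 * alpha - 1).
    replace (2 * alpha * c) with ((c + 1) * c) by (unfold c; ring).
    assert (c_neq0 : RtoC c <> C0) by (apply RtoC_neq0; unfold c; lra).
    assert (succ_c_neq0 : Cadd (RtoC c) C1 <> C0).
    { change C1 with (RtoC 1); rewrite <- RtoC_add; apply RtoC_neq0; unfold c; lra. }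
    rewrite RtoC_mul, RtoC_add; change (RtoC 1) with C1; eapply is_derive_Cx_eq.
    + apply (is_derive_Cdiv
        (fun w => Csub C1 (Cmul (Cpowc (Csub C1 w) (RtoC c)) (Cadd C1 (Cmul w (RtoC c)))))
        (fun _ => Cmul (Cadd (RtoC c) C1) (RtoC c))); [now apply Cmul_neq0| |apply is_derive_const].
      apply is_derive_Csub; [apply is_derive_const|].
      apply (is_derive_Cmul (fun w => Cpowc (Csub C1 w) (RtoC c))
               (fun w => Cadd C1 (Cmul w (RtoC c))));
        [now apply is_derive_pow_one_sub|].
      apply is_derive_Cadd; [apply is_derive_const|].
      apply (is_derive_Cmul (fun w => w)); [apply is_derive_id|apply is_derive_const].
    + change zero with C0; change one with C1; cbv beta; field; auto.
Qed.

Lemma re_halfplane (z : Cx) : inD z -> - / 2 < re (Cdiv z (Csub C1 z)).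
Proof.
  intros Hz; pose proof (Cnorm_sqr z) as Hsqr; pose proof (Cnorm_ge0 z); unfold inD in Hz.
  assert (Hlt : re z ^ 2 + im z ^ 2 < 1) by (rewrite <- Hsqr; nra).
  destruct z as [x y]; simpl in *.
  set (D := (1 + - x) * ((1 + - x) * 1) + (0 + - y) * ((0 + - y) * 1)).
  assert (HD : 0 < D) by (unfold D; nra).
  apply Rmult_lt_reg_r with D; auto.
  replace ((x * ((1 + - x) / D) - y * (- (0 + - y) / D)) * D) with (x * (1 - x) - y * y)
    by (field; lra).
  unfold D; nra.
Qed.

Lemma in_F_alpha (alpha : R) : alpha < 1 -> in_F alpha (h_alpha alpha) (g_alpha alpha).
Proof.
  intros Ha.
  exists (h1_alpha alpha), (h2_alpha alpha), (fun z => Cmul z (h1_alpha alpha z)), 0.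
  split; [|split; [|split]].
  - unfold h_alpha; rewrite one_sub_C0, Clog_1, Cpowc_1_l.
    destruct Req_EM_T; [|destruct Req_EM_T]; unfold Cdiv; ring.
  - unfold g_alpha; rewrite one_sub_C0, Clog_1, Cpowc_1_l.
    destruct Req_EM_T; [|destruct Req_EM_T]; unfold Cdiv; ring.
  - apply h1_alpha_C0.
  - intros z Hz; pose proof (h1_alpha_neq0 alpha z) as h1z_neq0.
    rewrite !Cderiv_at_is_derive.
    split; [now apply is_derive_h_alpha|]; split; [now apply is_derive_h1_alpha|].
    split; [now apply is_derive_g_alpha|]; split; auto; split.
    + replace (Cdiv (Cmul z (h2_alpha alpha z)) (h1_alpha alpha z))
        with (Cmul (RtoC (2 - 2 * alpha)) (Cdiv z (Csub C1 z)))
        by (unfold h2_alpha; field; split; auto; now apply one_sub_neq0).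
      pose proof (re_halfplane z Hz) as B; set (y := Cdiv z (Csub C1 z)) in *.
      clearbody y; simpl; nra.
    + rewrite Cexpi_0; ring.
Qed.

Lemma inD_rot (phi : R) (z : Cx) : inD z -> inD (Cmul (Cexpi phi) z).
Proof. unfold inD; now rewrite Cnorm_mul, Cnorm_Cexpi, Rmult_1_l. Qed.

Lemma is_derive_comp_rot (phi : R) (f : Cx -> Cx) (z l : Cx) :
  is_derive f (Cmul (Cexpi phi) z) l ->
  is_derive (fun w => f (Cmul (Cexpi phi) w)) z (Cmul (Cexpi phi) l).
Proof.
  intros Hf; eapply is_derive_Cx_eq.
  - apply (is_derive_Cx_comp f (fun w => Cmul (Cexpi phi) w)); [exact Hf|].
    apply is_derive_Cmul_const, is_derive_id.
  - change one with C1; ring.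
Qed.

Lemma is_derive_hrot (phi : R) (h : Cx -> Cx) (z l : Cx) :
  is_derive h (Cmul (Cexpi phi) z) l -> is_derive (hrot phi h) z l.
Proof.
  intros Hh; eapply is_derive_Cx_eq.
  - exact (is_derive_Cmul_const (Cexpi (- phi)) _ _ _ (is_derive_comp_rot phi h z l Hh)).
  - transitivity (Cmul (Cmul (Cexpi (- phi)) (Cexpi phi)) l); [ring|rewrite Cexpi_opp_l; ring].
Qed.

Lemma in_F_rot (alpha phi psi : R) (h g : Cx -> Cx) :
  in_F alpha h g -> in_F alpha (hrot phi h) (grot phi psi g).
Proof.
  intros [h1 [h2 [g1 [theta [h0 [g0 [h1_0 H]]]]]]]; set (e := Cexpi phi).
  assert (e_C0 : Cmul e C0 = C0) by ring.
  exists (fun z => h1 (Cmul e z)), (fun z => Cmul e (h2 (Cmul e z))),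
    (fun z => Cmul (Cexpi psi) (Cmul e (g1 (Cmul e z)))), (psi + (theta + (phi + phi))).
  unfold hrot at 1, grot at 1; fold e; rewrite e_C0, h0, g0, h1_0.
  split; [ring|]; split; [ring|]; split; [reflexivity|].
  intros z Hz; specialize (H _ (inD_rot phi z Hz)); fold e in H.
  rewrite !Cderiv_at_is_derive in H; destruct H as [Dh [Dh1 [Dg [h1_neq0 [Hre E]]]]].
  rewrite !Cderiv_at_is_derive.
  split; [now apply is_derive_hrot|]; split; [now apply (is_derive_comp_rot phi h1)|].
  split; [now apply is_derive_Cmul_const, (is_derive_comp_rot phi g)|].
  split; [exact h1_neq0|]; split.
  - now replace (Cmul z (Cmul e (h2 (Cmul e z)))) with (Cmul (Cmul e z) (h2 (Cmul e z))) by ring.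
  - rewrite E, !Cexpi_add; fold e; ring.
Qed.

Lemma derive_coef_binomial_ode (c : nat -> Cx) (f f1 : Cx -> Cx) (kappa : R) (e : Cx) (k : nat) :
  disc_series c f -> (forall z, inD z -> is_derive f z (f1 z)) ->
  (forall z, inD z ->
     Cmul (Csub C1 (Cmul e z)) (f1 z) = Cmul (Cmul (RtoC kappa) e) (f z)) ->
  derive_coef c k = Cmul (Cmul (RtoC (INR k + kappa)) e) (c k).
Proof.
  intros Sf Df Hode; pose proof (disc_series_derive c f f1 Sf Df) as Sf1.
  assert (Sode : disc_series
      (PS_plus (derive_coef c) (PS_scal (Copp e) (PS_incr_1 (derive_coef c))))
      (fun z => Cmul (Cmul (RtoC kappa) e) (f z))).
  { apply disc_series_ext with (2 := disc_series_plus _ _ _ _ Sf1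
      (disc_series_scal (Copp e) _ _ (disc_series_incr_1 _ _ Sf1))).
    intros z Hz; rewrite <- Hode by exact Hz; ring. }
  pose proof (disc_series_unique _ _ _ k Sode (disc_series_scal (Cmul (RtoC kappa) e) _ _ Sf)) as E.
  change (Cadd (derive_coef c k) (Cmul (Copp e) (PS_incr_1 (derive_coef c) k)) =
          Cmul (Cmul (RtoC kappa) e) (c k)) in E.
  rewrite PS_incr_1_derive_coef in E; rewrite RtoC_add.
  transitivity (Cadd (Cadd (derive_coef c k) (Cmul (Copp e) (Cmul (RtoC (INR k)) (c k))))
    (Cmul e (Cmul (RtoC (INR k)) (c k)))); [ring|rewrite E; ring].
Qed.

Lemma Cnorm_coef_hrot_alpha (alpha phi : R) (a : nat -> Cx) (n : nat) :
  alpha < 1 -> disc_series a (hrot phi (h_alpha alpha)) -> Cnorm (a (S n)) = A (S n) alpha.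
Proof.
  intros Ha Sh; set (e := Cexpi phi); set (c := derive_coef a).
  set (h1 := fun z => h1_alpha alpha (Cmul e z)).
  assert (Sc : disc_series c h1).
  { apply (disc_series_derive _ _ _ Sh); intros z Hz.
    apply is_derive_hrot, is_derive_h_alpha, inD_rot, Hz. }
  assert (Dh1 : forall z, inD z -> is_derive h1 z (Cmul e (h2_alpha alpha (Cmul e z)))).
  { intros z Hz; apply (is_derive_comp_rot phi), is_derive_h1_alpha, inD_rot, Hz. }
  assert (Hrec : forall k, INR (S k) * Cnorm (c (S k)) = (INR k + (2 - 2 * alpha)) * Cnorm (c k)).
  { intros k; rewrite <- Cnorm_derive_coef.
    rewrite (derive_coef_binomial_ode c h1 _ (2 - 2 * alpha) e k Sc Dh1).
    - rewrite !Cnorm_mul, Cnorm_RtoC; unfold e; rewrite Cnorm_Cexpi, Rabs_pos_eq; [ring|].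
      pose proof (pos_INR k); lra.
    - intros z Hz; unfold h2_alpha; fold (h1 z); field; apply one_sub_neq0, inD_rot, Hz. }
  assert (Hc : forall k, Cnorm (c k) = INR (S k) * A (S k) alpha).
  { induction k as [|k IH].
    - rewrite <- (disc_series_at_0 c h1 Sc), A_1; unfold h1.
      replace (Cmul e C0) with C0 by ring; rewrite h1_alpha_C0, Cnorm_C1; simpl; ring.
    - apply Rmult_eq_reg_l with (INR (S k)); [|apply not_0_INR; lia].
      rewrite Hrec, IH, INR_A_succ; ring. }
  specialize (Hc n); unfold c in Hc; rewrite Cnorm_derive_coef in Hc.
  apply Rmult_eq_reg_l with (INR (S n)); [exact Hc|apply not_0_INR; lia].
Qed.

Theorem theorem2 (alpha : R) (Ha : 0 <= alpha < 1) :
  (forall (h g : Cx -> Cx) (a b : nat -> Cx),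
     in_F alpha h g ->
     (forall z, inD z -> has_sum (fun k => Cmul (a k) (Cpow z k)) (h z)) ->
     (forall z, inD z -> has_sum (fun k => Cmul (b k) (Cpow z k)) (g z)) ->
     forall n : nat, (2 <= n)%nat ->
       Cnorm (a n) <= A n alpha /\
       Cnorm (b n) <= (INR n - 1) / (INR n - 2 * alpha) * A n alpha)
  /\
  (forall phi psi : R,
     in_F alpha (hrot phi (h_alpha alpha)) (grot phi psi (g_alpha alpha)) /\
     forall a b : nat -> Cx,
       (forall z, inD z ->
          has_sum (fun k => Cmul (a k) (Cpow z k)) (hrot phi (h_alpha alpha) z)) ->
       (forall z, inD z ->
          has_sum (fun k => Cmul (b k) (Cpow z k)) (grot phi psi (g_alpha alpha) z)) ->
       forall n : nat, (2 <= n)%nat ->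
         Cnorm (a n) = A n alpha /\
         Cnorm (b n) = (INR n - 1) / (INR n - 2 * alpha) * A n alpha).
Proof.
  split.
  - intros h g a b HF Sh Sg [|[|n]] Hn; [lia|lia|].
    apply disc_series_of_has_sum in Sh, Sg.
    assert (Hcoef : forall k, Cnorm (a (S k)) <= A (S k) alpha)
      by (intros k; apply (in_F_coef_le alpha h g); auto; lra).
    split; [apply Hcoef|].
    rewrite conj_bound_A, (in_F_conj_coef alpha h g a b n HF Sh Sg) by lra.
    apply Rmult_le_compat_l; [|apply Hcoef].
    apply Rdiv_le_0_compat; [apply pos_INR|apply lt_0_INR; lia].
  - intros phi psi.
    assert (HF : in_F alpha (hrot phi (h_alpha alpha)) (grot phi psi (g_alpha alpha)))
      by (apply in_F_rot, in_F_alpha; lra).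
    split; [exact HF|]; intros a b Sh Sg [|[|n]] Hn; [lia|lia|].
    apply disc_series_of_has_sum in Sh, Sg.
    split; [apply (Cnorm_coef_hrot_alpha alpha phi); auto; lra|].
    rewrite conj_bound_A, (in_F_conj_coef alpha _ _ a b n HF Sh Sg) by lra.
    now rewrite (Cnorm_coef_hrot_alpha alpha phi) by (auto; lra).
Qed.
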